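(* Consider the mean-square-error risk $J(w)=\frac12\mathbb E(\boldsymbol d(i)-\boldsymbol u_i^{\mathsf T}w)^2$ with the data model described in the context, the LMS recursion $$\boldsymbol x_i=\boldsymbol x_{i-1}+\mu\,\boldsymbol u_i(\boldsymbol d(i)-\boldsymbol u_i^{\mathsf T}\boldsymbol x_{i-1}),\qquad i\ge0,$$ and the momentum LMS recursion, for $i\ge 0$, $$\boldsymbol\psi_{i-1}=\boldsymbol w_{i-1}+\beta_1(\boldsymbol w_{i-1}-\boldsymbol w_{i-2}),\qquad \boldsymbol w_i=\boldsymbol\psi_{i-1}+\mu_m\boldsymbol u_i(\boldsymbol d(i)-\boldsymbol u_i^{\mathsf T}\boldsymbol\psi_{i-1})+\beta_2(\boldsymbol\psi_{i-1}-\boldsymbol\psi_{i-2}),$$ with $\boldsymbol w_{-1}=\boldsymbol w_{-2}+\mu_m\boldsymbol u_{-1}(\boldsymbol d(-1)-\boldsymbol u_{-1}^{\mathsf T}\boldsymbol w_{-2})$. Assume: (i) $0<\nu I_M\le\nabla^2J(w)\le\delta I_M$; (ii) for every $\mathcal F_{i-1}$-measurable random vector $\boldsymbol w$, almost surely, $\mathbb E[\boldsymbol s_i(\boldsymbol w)\mid\mathcal F_{i-1}]=0$ and $\mathbb E[\|\boldsymbol s_i(\boldsymbol w)\|^2\mid\mathcal F_{i-1}]\le\gamma^2\|w^o-\boldsymbol w\|^2+\sigma_s^2$ with nonnegative constants $\gamma^2,\sigma_s^2$; (iii) $\beta_1,\beta_2\in[0,1)$ satisfy $\beta_1+\beta_2=\beta$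 and $\beta_1\beta_2=0$, where $\beta\in[0,1)$ is a constant with $\beta\le1-\epsilon$ for some fixed $\epsilon>0$; (iv) both algorithms start from the same initial states, $\boldsymbol\psi_{-2}=\boldsymbol w_{-2}=\boldsymbol x_{-1}$; (v) the step-sizes satisfy $\mu=\frac{\mu_m}{1-\beta}$. Then, for sufficiently small $\mu$ and for all $i=0,1,2,3,\dots$, $$\mathbb E\|\boldsymbol w_i-\boldsymbol x_i\|^2=O\left(\left[\frac{\delta^2+\gamma^2}{(1-\beta)^2}\rho_1^{\,i+1}+\frac{\delta^2\sigma_s^2}{\nu^2(1-\beta)}\right]\mu^2+\frac{\delta^2(\delta^2+\gamma^2)(i+1)\rho_1^{\,i+1}}{\nu(1-\beta)^2}\mu^3\right),$$ where $\rho_1=1-\frac{\mu\nu}{2}\in(0,1)$.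
   Context: Data model: $\boldsymbol d(i)$ is a sequence of zero-mean random variables with variance $\sigma_d^2$; $\boldsymbol u_i\in\mathbb R^M$ is a sequence of independent zero-mean random vectors with covariance $R_u=\mathbb E\boldsymbol u_i\boldsymbol u_i^{\mathsf T}>0$; the data are wide-sense stationary and satisfy $\boldsymbol d(i)=\boldsymbol u_i^{\mathsf T}w^o+\boldsymbol v(i)$ for some unknown $w^o\in\mathbb R^M$, where $\boldsymbol v(i)$ is a zero-mean white noise process with power $\sigma_v^2$, independent of $\boldsymbol u_j$ for all $i,j$. Then $w^o$ is the unique minimizer of $J$, $\nabla^2J(w)=R_u$, so one may take $\nu=\lambda_{\min}(R_u)$, $\delta=\lambda_{\max}(R_u)$. The gradient noise is $\boldsymbol s_i(\boldsymbol w)=(R_u-\boldsymbol u_i\boldsymbol u_i^{\mathsf T})(w^o-\boldsymbol w)-\boldsymbol u_i\boldsymbol v(i)$. Both recursions use the same data stream. $\mathcal F_{i-1}$ is the $\sigma$-algebra generated by the iterates of the recursions up to time $i-1$ (including the initial states). Second moments of the initial states are finite. $O(\cdot)$ is uniform: the hidden constant does not depend on $i$ or $\mu$, but may depend on other fixed problem data and the initial state; ''sufficiently small $\mu$'' means all $\mu\in(0,\bar\mu)$ for some $\bar\mu>0$. The noise constants do not depend on $i$ or the step-sizes. *)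

(* Defs.v *)
(* Vectors of R^M are columns 'cV[R]_M, and time runs over int because the
   recursions are initialised at the negative times -1 and -2. *)
From HB Require Import structures.
From mathcomp Require Export all_boot all_order all_algebra.
From mathcomp Require Export all_classical all_reals all_analysis.
From mathcomp Require Export measurable_realfun.

Set Implicit Arguments.
Unset Strict Implicit.
Unset Printing Implicit Defensive.

Export Order.TTheory GRing.Theory Num.Theory.
Export numFieldNormedType.Exports.

Open Scope classical_set_scope.
Open Scope ring_scope.

Section LinearAlgebra.
Context {R : realType} {M : nat}.

Definition dotv (a b : 'cV[R]_M) : R := (a^T *m b) 0 0.

(* The library norm on matrices is the sup norm, hence this Euclidean one. *)
Definition sqnorm (a : 'cV[R]_M) : R := dotv a a.

Definition posdef (A : 'M[R]_M) : Prop :=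
  forall a : 'cV[R]_M, a != 0 -> 0 < dotv a (A *m a).

Definition loewner_le (A B : 'M[R]_M) : Prop :=
  forall a : 'cV[R]_M, dotv a (A *m a) <= dotv a (B *m a).

Definition hessian (f : 'cV[R]_M -> R) (a : 'cV[R]_M) : 'M[R]_M :=
  \matrix_(k, l)
    'D_(delta_mx k 0) (fun b => 'D_(delta_mx l 0) (f : 'cV[R]_M -> R^o) b : R^o) a.

End LinearAlgebra.

Section Probability.
Context {disp : measure_display} {T : measurableType disp} {R : realType}.
Variable P : probability T R.

Definition random_vector {M : nat} (X : T -> 'cV[R]_M) : Prop :=
  forall k, measurable_fun [set: T] (fun t => X t k 0).

(* Generators of the sigma-algebra of X; the sigma-algebra is <<s vec_events X>>. *)
Definition vec_events {M : nat} (X : T -> 'cV[R]_M) : set (set T) :=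
  \bigcup_(k in [set: 'I_M])
    preimage_set_system [set: T] (fun t => X t k 0) (@measurable _ R).

Definition independent_events (F G : set (set T)) : Prop :=
  forall A B, F A -> G B -> P (A `&` B) = (P A * P B)%E.

Definition mutually_independent {M : nat} (D : set int)
    (X : int -> T -> 'cV[R]_M) : Prop :=
  forall (s : seq int) (A : int -> set T), uniq s ->
    (forall i, i \in s -> D i /\ <<s vec_events (X i) >> (A i)) ->
    P (\bigcap_(i in [set` s]) A i) = (\prod_(i <- s) fine (P (A i)))%:E.

Definition wide_sense_stationary {M : nat} (D : set int)
    (Z : int -> T -> 'cV[R]_M) : Prop :=
  [/\ forall i k, D i -> ('E_P[fun t => (Z i t k 0 ^+ 2)%R] < +oo)%E,
      forall i j k, D i -> D j ->
        'E_P[fun t => (Z i t k 0)%R]%E = 'E_P[fun t => (Z j t k 0)%R]%E &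
      forall i j h k l, D i -> D j -> D (i + h) -> D (j + h) ->
        covariance P (fun t => Z (i + h) t k 0) (fun t => Z (j + h) t l 0) =
        covariance P (fun t => Z i t k 0) (fun t => Z j t l 0)].

Definition white_noise (D : set int) (v : int -> T -> R) (sigma : R) : Prop :=
  [/\ forall i, D i -> measurable_fun [set: T] (v i),
      forall i, D i -> 'E_P[v i]%E = 0%E &
      forall i j, D i -> D j ->
        'E_P[fun t => (v i t * v j t)%R]%E =
          (if i == j then sigma ^+ 2 else 0)%:E].

Definition measurable_wrt {d'} {U : measurableType d'} (G : set (set T))
    (f : T -> U) : Prop :=
  measurable_fun [set: g_sigma_algebraType G] (f : g_sigma_algebraType G -> U).

(* Y is a version of the conditional expectation of the nonnegative X given
   the sigma-algebra <<s G>>. *)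
Definition is_condexp_ge0 (G : set (set T)) (X Y : T -> \bar R) : Prop :=
  [/\ forall t, (0 <= Y t)%E,
      measurable_wrt G Y &
      forall A, G.-sigma.-measurable A ->
        (\int[P]_(t in A) Y t = \int[P]_(t in A) X t)%E].

(* Y is a version of the conditional expectation of X: the difference of those
   of the positive and negative parts of X, which must almost surely not be
   both infinite. This agrees with the usual notion for integrable X, but X
   need not be integrable: in noise_condition the vector y is arbitrary. *)
Definition is_condexp (G : set (set T)) (X Y : T -> \bar R) : Prop :=
  measurable_wrt G Y /\
  exists Yp Yn : T -> \bar R,
    [/\ is_condexp_ge0 G (X^\+)%E Yp, is_condexp_ge0 G (X^\-)%E Yn,
        {ae P, forall t, (Yp t < +oo)%E \/ (Yn t < +oo)%E} &
        {ae P, forall t, Y t = (Yp t - Yn t)%E}].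

End Probability.

(* The recursions use the data of the times i >= -1 only. *)
Definition data_times : set int := [set i | -1 <= i].

Section MeanSquareError.
Context {disp : measure_display} {T : measurableType disp} {R : realType}.
Context {M : nat}.
Variable P : probability T R.

(* Joint stationarity of d and u is that of the stacked vector (d(i), u_i);
   the noise v(i) is independent of each u_j separately. *)
Record mse_data_model (d v : int -> T -> R) (u : int -> T -> 'cV[R]_M)
    (w_opt : 'cV[R]_M) (R_u : 'M[R]_M) (sigma_d sigma_v : R) : Prop := {
  mse_d_meas : forall i, data_times i -> measurable_fun [set: T] (d i);
  mse_d_mean : forall i, data_times i -> 'E_P[d i]%E = 0%E;
  mse_d_var : forall i, data_times i -> variance P (d i) = (sigma_d ^+ 2)%:E;
  mse_u_meas : forall i, data_times i -> random_vector (u i);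
  mse_u_indep : mutually_independent P data_times u;
  mse_u_mean : forall i k, data_times i -> 'E_P[fun t => (u i t k 0)%R]%E = 0%E;
  mse_u_cov : forall i k l, data_times i ->
    'E_P[fun t => ((u i t *m (u i t)^T) k l)%R]%E = (R_u k l)%:E;
  mse_R_u_pos : posdef R_u;
  mse_stationary : wide_sense_stationary P data_times
    (fun i t => col_mx ((d i t)%:M : 'cV[R]_1) (u i t));
  mse_v_white : white_noise P data_times v sigma_v;
  mse_v_u_indep : forall i j, data_times i -> data_times j ->
    independent_events P (preimage_set_system [set: T] (v i) (@measurable _ R))
                         (<<s vec_events (u j) >>);
  mse_linear : forall i t, data_times i ->
    d i t = dotv (u i t) w_opt + v i t
}.

Definition mse_risk (d : T -> R) (u : T -> 'cV[R]_M) (w : 'cV[R]_M) : R :=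
  2^-1 * fine 'E_P[fun t => ((d t - dotv (u t) w) ^+ 2)%R]%E.

Definition lms_recursion (mu : R) (d : int -> T -> R) (u : int -> T -> 'cV[R]_M)
    (x : int -> T -> 'cV[R]_M) : Prop :=
  forall i t, 0 <= i ->
    x i t = x (i - 1) t
            + mu *: ((d i t - dotv (u i t) (x (i - 1) t)) *: u i t).

Record momentum_lms_recursion (mu_m beta1 beta2 : R) (d : int -> T -> R)
    (u : int -> T -> 'cV[R]_M) (w psi : int -> T -> 'cV[R]_M) : Prop := {
  momentum_start : forall t,
    w (-1) t = w (-2) t
      + mu_m *: ((d (-1) t - dotv (u (-1) t) (w (-2) t)) *: u (-1) t);
  momentum_psi : forall i t, 0 <= i ->
    psi (i - 1) t = w (i - 1) t + beta1 *: (w (i - 1) t - w (i - 2) t);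
  momentum_w : forall i t, 0 <= i ->
    w i t = psi (i - 1) t
      + mu_m *: ((d i t - dotv (u i t) (psi (i - 1) t)) *: u i t)
      + beta2 *: (psi (i - 1) t - psi (i - 2) t)
}.

(* Generators of F_i: all iterates up to time i, initial states included. *)
Definition history (x w psi : int -> T -> 'cV[R]_M) (i : int) : set (set T) :=
  \bigcup_(j in [set j | -1 <= j <= i]) vec_events (x j) `|`
  \bigcup_(j in [set j | -2 <= j <= i])
    (vec_events (w j) `|` vec_events (psi j)).

Definition grad_noise (R_u : 'M[R]_M) (w_opt : 'cV[R]_M)
    (u : int -> T -> 'cV[R]_M) (v : int -> T -> R) (i : int)
    (y : T -> 'cV[R]_M) (t : T) : 'cV[R]_M :=
  (R_u - u i t *m (u i t)^T) *m (w_opt - y t) - v i t *: u i t.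

Definition noise_condition (R_u : 'M[R]_M) (w_opt : 'cV[R]_M)
    (u : int -> T -> 'cV[R]_M) (v : int -> T -> R) (gamma sigma_s : R)
    (i : int) (G : set (set T)) : Prop :=
  forall y : T -> 'cV[R]_M,
    (forall k, measurable_wrt G (fun t => y t k 0)) ->
    let s := grad_noise R_u w_opt u v i y in
    (forall k, is_condexp P G (fun t => (s t k 0)%:E) (cst 0%E)) /\
    (exists2 S : T -> \bar R,
       is_condexp P G (fun t => (sqnorm (s t))%:E) S &
       {ae P, forall t,
          (S t <= (gamma ^+ 2 * sqnorm (w_opt - y t) + sigma_s ^+ 2)%:E)%E}).

End MeanSquareError.

(* Main.v *)
Require Import Defs.
From mathcomp Require Import ring lra zify.

(** Put [m_i = w_i - w_{i-1}] and [z_i = w_i + beta / (1 - beta) m_i]. In both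
    variants of momentum allowed by [beta1 beta2 = 0] one finds
      [m_i = beta m_{i-1} - (1 - beta) mu g_i],  [z_i = z_{i-1} - mu g_i],
    where [g_i] is the stochastic gradient at
    [psi_{i-1} = z_{i-1} - lag_coef m_{i-1}]. So the extrapolated iterate [z_i]
    is a plain LMS iterate with the step-size [mu] of [x_i], except that its
    gradient is read at a point displaced by a multiple of the velocity. The
    two recursions see the same measurement noise, which therefore cancels in
    the gap [e_i = z_i - x_i]: with [H_i = u_i u_i^T],
      [e_i = e_{i-1} - mu H_i (e_{i-1} - lag_coef m_{i-1})].
    The gap is a contracting recursion driven by the velocity only, and the
    velocity is of order [mu].

    To make this quantitative, [H_i] is split into its mean [R_u] and a
    fluctuation. The noise condition, evaluated at suitable adapted vectors,
    says that the fluctuation is conditionally centred and that its mean square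
    is at most [gamma^2] times that of the vector it acts on
    ([fluctuation_orthogonal], [fluctuation_mean_sq]). Hence, with
    [Z_i = E |w_opt - z_i|^2], [Q_i = E |m_i|^2], [E_i = E |e_i|^2] and a
    constant [c] ([mean_sq_recursions]),
      [Z_i <= (1 - mu nu) Z_{i-1} + c mu Q_{i-1} + c mu sigma_s^2],
      [Q_i <= (beta + c mu^2) Q_{i-1} + c mu^2 (Z_{i-1} + sigma_s^2)],
      [E_i <= (1 - mu nu) E_{i-1} + c mu Q_{i-1}].
    These are solved in [coupled_recursion_bound]: [Z_i + Q_i] is of order
    [rho1^i + sigma_s^2], then [Q_i] of order [mu^2 (rho1^i + sigma_s^2)], and
    feeding this into the last recursion gives the claim; the term
    [i rho1^i mu^3] is the resonance of a forcing that decays at the same rate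
    [rho1] as the recursion it drives. The Hessian of the risk is [R_u]
    ([hessian_mse_risk]), which is how [nu] bounds [R_u] from below. *)

Set Implicit Arguments.
Unset Strict Implicit.
Unset Printing Implicit Defensive.

(** * Euclidean geometry of column vectors *)

Section EuclideanGeometry.
Context {R : realType} {M : nat}.
Implicit Types (a b c : 'cV[R]_M) (A : 'M[R]_M) (k : R).

Lemma dotvE a b : dotv a b = \sum_j a j 0 * b j 0.
Proof. by rewrite /dotv mxE; apply: eq_bigr => j _; rewrite mxE. Qed.

Lemma dotvC a b : dotv a b = dotv b a.
Proof. by rewrite !dotvE; apply: eq_bigr => j _; rewrite mulrC. Qed.

Lemma dotvDr a b c : dotv a (b + c) = dotv a b + dotv a c.
Proof. by rewrite /dotv mulmxDr mxE. Qed.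

Lemma dotvDl a b c : dotv (a + b) c = dotv a c + dotv b c.
Proof. by rewrite ![dotv _ c]dotvC dotvDr. Qed.

Lemma dotvZr k a b : dotv a (k *: b) = k * dotv a b.
Proof. by rewrite /dotv -scalemxAr mxE. Qed.

Lemma dotvZl k a b : dotv (k *: a) b = k * dotv a b.
Proof. by rewrite dotvC dotvZr dotvC. Qed.

Lemma dotvNr a b : dotv a (- b) = - dotv a b.
Proof. by rewrite -scaleN1r dotvZr mulN1r. Qed.

Lemma dotv0r a : dotv a 0 = 0.
Proof. by rewrite /dotv mulmx0 mxE. Qed.

Lemma dotv_delta_l j a : dotv (delta_mx j 0) a = a j 0.
Proof.
rewrite dotvE (bigD1 j)//= big1 ?addr0 ?mxE ?eqxx ?mul1r// => l lj.
by rewrite mxE (negbTE lj) mul0r.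
Qed.

Lemma dotv_mulmxl A a b : dotv (A *m a) b = dotv a (A^T *m b).
Proof. by rewrite /dotv trmx_mul mulmxA. Qed.

Lemma sqnorm_ge0 a : 0 <= sqnorm a.
Proof. by rewrite /sqnorm dotvE sumr_ge0// => j _; rewrite -expr2 sqr_ge0. Qed.

Lemma sqnorm0 : sqnorm (0 : 'cV[R]_M) = 0.
Proof. by rewrite /sqnorm dotv0r. Qed.

Lemma sqnorm_eq0 a : sqnorm a = 0 -> a = 0.
Proof.
rewrite /sqnorm dotvE => /eqP; rewrite psumr_eq0 => [/allP a0|j _]; last first.
  by rewrite -expr2 sqr_ge0.
apply/matrixP => j l; rewrite ord1 mxE.
by have := a0 j (mem_index_enum _); rewrite mulf_eq0 orbb => /eqP.
Qed.

Lemma sqnormD a b : sqnorm (a + b) = sqnorm a + 2 * dotv a b + sqnorm b.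
Proof. by rewrite /sqnorm dotvDl !dotvDr (dotvC b a); ring. Qed.

Lemma sqnormZ k a : sqnorm (k *: a) = k ^+ 2 * sqnorm a.
Proof. by rewrite /sqnorm dotvZl dotvZr mulrA expr2. Qed.

Lemma sqnormN a : sqnorm (- a) = sqnorm a.
Proof. by rewrite -scaleN1r sqnormZ sqrrN expr1n mul1r. Qed.

(** The parameter trades the growth of one term against the weight of the
    other. *)
Lemma sqnormD_young (s : R) a b : 0 < s ->
  sqnorm (a + b) <= (1 + s) * sqnorm a + (1 + s^-1) * sqnorm b.
Proof.
move=> s0; rewrite sqnormD.
have : 0 <= s^-1 * sqnorm (s *: a - b).
  by rewrite mulr_ge0 ?sqnorm_ge0// invr_ge0 ltW.
rewrite sqnormD sqnormZ sqnormN dotvNr dotvZl.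
have -> : s^-1 * (s ^+ 2 * sqnorm a + 2 * - (s * dotv a b) + sqnorm b)
   = s * sqnorm a - 2 * dotv a b + s^-1 * sqnorm b by field; rewrite gt_eqF.
lra.
Qed.

Lemma sqnormD2 a b : sqnorm (a + b) <= 2 * sqnorm a + 2 * sqnorm b.
Proof. by have := sqnormD_young a b (@ltr01 R); rewrite invr1; lra. Qed.

Lemma sqnorm_convex (s : R) a b : 0 <= s < 1 ->
  sqnorm (s *: a + (1 - s) *: b) <= s * sqnorm a + (1 - s) * sqnorm b.
Proof.
move=> /andP[s0 s1]; rewrite sqnormD !sqnormZ dotvZl dotvZr.
have := mulr_ge0 (mulr_ge0 s0 (ltW (etrans (subr_gt0 _ _) s1))) (sqnorm_ge0 (a - b)).
rewrite sqnormD sqnormN dotvNr; lra.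
Qed.

Lemma dotv_le_sqnorm a b : 2 * `|dotv a b| <= sqnorm a + sqnorm b.
Proof.
have := sqnorm_ge0 (a + b); have := sqnorm_ge0 (a - b).
rewrite !sqnormD sqnormN dotvNr => h1 h2.
by case: (ger0P (dotv a b)) => _; lra.
Qed.

Lemma dotv_cauchy_schwarz a b : dotv a b ^+ 2 <= sqnorm a * sqnorm b.
Proof.
have [b0|b0] := eqVneq (sqnorm b) 0.
  by rewrite b0 (sqnorm_eq0 b0) dotv0r expr0n mulr0.
have bp : 0 < sqnorm b by rewrite lt_neqAle eq_sym b0 sqnorm_ge0.
have := sqnorm_ge0 (sqnorm b *: a - dotv a b *: b).
rewrite sqnormD sqnormN !sqnormZ dotvNr dotvZl dotvZr => h.
rewrite -subr_ge0 -(pmulr_rge0 _ bp); nra.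
Qed.

Lemma sqnorm_mulmx_bounded A :
  exists2 r : R, 0 <= r & forall a, sqnorm (A *m a) <= r * sqnorm a.
Proof.
exists (\sum_j sqnorm (row j A)^T); first by apply: sumr_ge0 => j _; exact: sqnorm_ge0.
move=> a; rewrite {1}/sqnorm dotvE mulr_suml ler_sum// => j _.
have -> : (A *m a) j 0 = dotv (row j A)^T a.
  by rewrite dotvE mxE; apply: eq_bigr => l _; rewrite !mxE.
by rewrite -expr2 dotv_cauchy_schwarz.
Qed.

(** The gradient step of a quadratic risk contracts, up to second order in the
    step-size, at twice the rate of strong convexity. *)
Lemma sqnorm_gradient_step A (nu r mu : R) a : 0 <= mu ->
    loewner_le nu%:M A -> (forall b, sqnorm (A *m b) <= r * sqnorm b) ->
  sqnorm (a - mu *: (A *m a)) <= (1 - 2 * mu * nu + mu ^+ 2 * r) * sqnorm a.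
Proof.
move=> mu0 nuA rA; rewrite sqnormD sqnormN sqnormZ dotvNr dotvZr.
have := nuA a; rewrite mul_scalar_mx dotvZr -/(sqnorm a) => h.
have h1 := ler_wpM2l mu0 h.
have h2 := ler_wpM2l (sqr_ge0 mu) (rA a).
by nra.
Qed.

End EuclideanGeometry.

(** * Random vectors and mean squares *)

Section RandomVectors.
Context {disp : measure_display} {T : measurableType disp} {R : realType}.
Context {M : nat}.
Implicit Types (X Y : T -> 'cV[R]_M) (f : T -> R).

Lemma random_vector_cst (a : 'cV[R]_M) : random_vector (fun _ : T => a).
Proof. by move=> k; exact: measurable_cst. Qed.

Lemma random_vectorD X Y : random_vector X -> random_vector Y ->
  random_vector (fun t => X t + Y t).
Proof.
move=> mX mY k; rewrite [X in measurable_fun _ X](_ : _ = (fun t => X t k 0 + Y t k 0)).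
  exact: measurable_funD.
by apply/funext => t; rewrite mxE.
Qed.

Lemma random_vectorZ f X : measurable_fun [set: T] f -> random_vector X ->
  random_vector (fun t => f t *: X t).
Proof.
move=> mf mX k; rewrite [X in measurable_fun _ X](_ : _ = (fun t => f t * X t k 0)).
  exact: measurable_funM.
by apply/funext => t; rewrite mxE.
Qed.

Lemma random_vectorZc (c : R) X : random_vector X ->
  random_vector (fun t => c *: X t).
Proof. by move=> mX; apply: (random_vectorZ _ mX); exact: measurable_cst. Qed.

Lemma random_vectorN X : random_vector X -> random_vector (fun t => - X t).
Proof.
move=> mX; under [X in random_vector X]eq_fun do rewrite -scaleN1r.
exact: random_vectorZc.
Qed.

Lemma random_vectorB X Y : random_vector X -> random_vector Y ->
  random_vector (fun t => X t - Y t).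
Proof. by move=> mX mY; apply: random_vectorD => //; exact: random_vectorN. Qed.

Lemma measurable_dotv X Y : random_vector X -> random_vector Y ->
  measurable_fun [set: T] (fun t => dotv (X t) (Y t)).
Proof.
move=> mX mY; under eq_fun do rewrite dotvE.
by apply: measurable_sum => j; apply: measurable_funM.
Qed.

Lemma random_vector_mulmx (A : 'M[R]_M) X : random_vector X ->
  random_vector (fun t => A *m X t).
Proof.
move=> mX k.
rewrite [X in measurable_fun _ X](_ : _ = (fun t => dotv (row k A)^T (X t))).
  by apply: measurable_dotv => //; exact: random_vector_cst.
by apply/funext => t; rewrite dotvE mxE; apply: eq_bigr => l _; rewrite !mxE.
Qed.

End RandomVectors.

Section SquareIntegrable.
Context {disp : measure_display} {T : measurableType disp} {R : realType}.
Variable P : probability T R.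
Context {M : nat}.
Implicit Types (X Y Z : T -> 'cV[R]_M) (f : T -> R).

Definition sq_integrable X : Prop :=
  random_vector X /\ P.-integrable [set: T] (EFin \o (fun t => sqnorm (X t))).

Definition mean_sq X : R := \int[P]_t sqnorm (X t).

Definition mean_dot X Y : R := \int[P]_t dotv (X t) (Y t).

Lemma mean_sq_ge0 X : 0 <= mean_sq X.
Proof. by apply: Rintegral_ge0 => t _; exact: sqnorm_ge0. Qed.

Lemma expectation_sqnormE X : sq_integrable X ->
  'E_P[fun t => sqnorm (X t)]%E = (mean_sq X)%:E.
Proof.
by move=> [_ iX]; rewrite unlock /mean_sq /Rintegral fineK// integrable_fin_num.
Qed.

Lemma sq_integrableP X : random_vector X ->
  ('E_P[fun t => sqnorm (X t)] < +oo)%E -> sq_integrable X.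
Proof.
move=> mX; rewrite unlock => fX; split => //; apply/integrableP; split.
  by apply/measurable_EFinP; exact: measurable_dotv.
apply: le_lt_trans fX; rewrite le_eqVlt; apply/orP; left; apply/eqP.
by apply: eq_integral => t _ /=; rewrite ger0_norm ?sqnorm_ge0.
Qed.

Lemma Rintegral_probability_cst (c : R) : \int[P]_t c = c.
Proof. by have := expectation_cst P c; rewrite unlock /Rintegral => ->. Qed.

Lemma integrable_add f g : P.-integrable [set: T] (EFin \o f) ->
  P.-integrable [set: T] (EFin \o g) ->
  P.-integrable [set: T] (EFin \o (fun t => f t + g t)).
Proof. by move=> fi gi; exact: (integrableD measurableT fi gi). Qed.

Lemma integrable_scale (c : R) f : P.-integrable [set: T] (EFin \o f) ->
  P.-integrable [set: T] (EFin \o (fun t => c * f t)).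
Proof. by move=> fi; exact: (integrableZl measurableT c fi). Qed.

Lemma integrable_sumr (I : Type) (r : seq I) (h : I -> T -> R) :
  (forall j, P.-integrable [set: T] (EFin \o h j)) ->
  P.-integrable [set: T] (EFin \o (fun t => \sum_(j <- r) h j t)).
Proof.
move=> ih; elim: r => [|j r IHr].
  under [X in EFin \o X]eq_fun do rewrite big_nil.
  exact: finite_measure_integrable_cst.
under [X in EFin \o X]eq_fun do rewrite big_cons.
exact: integrable_add.
Qed.

Lemma Rintegral_sum (I : Type) (r : seq I) (h : I -> T -> R) :
  (forall j, P.-integrable [set: T] (EFin \o h j)) ->
  \int[P]_t (\sum_(j <- r) h j t) = \sum_(j <- r) \int[P]_t h j t.
Proof.
move=> ih; elim: r => [|j r IHr].
  by under eq_Rintegral do rewrite big_nil; rewrite Rintegral_probability_cst big_nil.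
under eq_Rintegral do rewrite big_cons.
by rewrite big_cons RintegralD// ?IHr//; exact: integrable_sumr.
Qed.

Lemma integrable_le f g : measurable_fun [set: T] f ->
  P.-integrable [set: T] (EFin \o g) -> (forall t, `|f t| <= g t) ->
  P.-integrable [set: T] (EFin \o f).
Proof.
move=> mf ig fg; apply: le_integrable ig => //; first exact/measurable_EFinP.
by move=> t _ /=; rewrite lee_fin (le_trans (fg t))// ler_norm.
Qed.

(** Turns a pointwise inequality between squared norms into one between mean
    squares, with square integrability on the way. *)
Lemma mean_sq_le X Y Z (a b : R) : random_vector X ->
  sq_integrable Y -> sq_integrable Z ->
  (forall t, sqnorm (X t) <= a * sqnorm (Y t) + b * sqnorm (Z t)) ->
  sq_integrable X /\ mean_sq X <= a * mean_sq Y + b * mean_sq Z.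
Proof.
move=> mX [mY iY] [mZ iZ] XYZ.
have iaY : P.-integrable [set: T] (EFin \o (fun t => a * sqnorm (Y t))).
  exact: integrable_scale.
have ibZ : P.-integrable [set: T] (EFin \o (fun t => b * sqnorm (Z t))).
  exact: integrable_scale.
have iYZ : P.-integrable [set: T]
    (EFin \o (fun t => a * sqnorm (Y t) + b * sqnorm (Z t))).
  exact: integrable_add.
have iX : P.-integrable [set: T] (EFin \o (fun t => sqnorm (X t))).
  apply: integrable_le iYZ _ => [|t]; first exact: measurable_dotv.
  by rewrite ger0_norm ?sqnorm_ge0.
split => //; rewrite /mean_sq -!RintegralZl// -RintegralD//.
by apply: le_Rintegral.
Qed.

Lemma sq_integrable_cst (a : 'cV[R]_M) : sq_integrable (fun=> a).
Proof.
split; first exact: random_vector_cst.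
by apply: finite_measure_integrable_cst.
Qed.

Lemma sq_integrableD X Y : sq_integrable X -> sq_integrable Y ->
  sq_integrable (fun t => X t + Y t).
Proof.
move=> iX iY.
by apply: (@mean_sq_le _ X Y 2 2 _ iX iY (fun t => sqnormD2 _ _)).1;
  apply: random_vectorD; [exact: iX.1|exact: iY.1].
Qed.

Lemma mean_sqZ (c : R) X : sq_integrable X ->
  mean_sq (fun t => c *: X t) = c ^+ 2 * mean_sq X.
Proof.
move=> [_ iX]; rewrite /mean_sq -RintegralZl//.
by apply: eq_Rintegral => t _; rewrite sqnormZ.
Qed.

Lemma sq_integrableZ (c : R) X : sq_integrable X ->
  sq_integrable (fun t => c *: X t).
Proof.
move=> iX; apply: (@mean_sq_le _ X X (c ^+ 2) 0 _ iX iX _).1.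
  exact: random_vectorZc iX.1.
by move=> t; rewrite sqnormZ mul0r addr0.
Qed.

Lemma sq_integrableN X : sq_integrable X -> sq_integrable (fun t => - X t).
Proof.
move=> iX; under [X in sq_integrable X]eq_fun do rewrite -scaleN1r.
exact: sq_integrableZ.
Qed.

Lemma sq_integrableB X Y : sq_integrable X -> sq_integrable Y ->
  sq_integrable (fun t => X t - Y t).
Proof. by move=> iX iY; apply: sq_integrableD => //; exact: sq_integrableN. Qed.

Lemma sq_integrable_mulmx (A : 'M[R]_M) X : sq_integrable X ->
  sq_integrable (fun t => A *m X t).
Proof.
move=> iX; have [r _ rA] := sqnorm_mulmx_bounded A.
apply: (@mean_sq_le _ X X r 0 _ iX iX _).1.
  exact: random_vector_mulmx iX.1.
by move=> t; rewrite mul0r addr0.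
Qed.

Lemma integrable_dotv X Y : sq_integrable X -> sq_integrable Y ->
  P.-integrable [set: T] (EFin \o (fun t => dotv (X t) (Y t))).
Proof.
move=> [mX iX] [mY iY].
have iXY : P.-integrable [set: T] (EFin \o (fun t => sqnorm (X t) + sqnorm (Y t))).
  exact: integrable_add.
apply: integrable_le iXY _ => [|t]; first exact: measurable_dotv.
by have := dotv_le_sqnorm (X t) (Y t); have := normr_ge0 (dotv (X t) (Y t)); lra.
Qed.

Lemma mean_sqD X Y : sq_integrable X -> sq_integrable Y ->
  mean_sq (fun t => X t + Y t) = mean_sq X + 2 * mean_dot X Y + mean_sq Y.
Proof.
move=> iX iY; have iXY := integrable_dotv iX iY.
have i2 : P.-integrable [set: T] (EFin \o (fun t => 2 * dotv (X t) (Y t))).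
  exact: integrable_scale.
rewrite /mean_sq /mean_dot -RintegralZl// -RintegralD//; last exact: iX.2.
rewrite -RintegralD//; last exact: iY.2.
  by apply: eq_Rintegral => t _; rewrite sqnormD.
by apply: integrable_add => //; exact: iX.2.
Qed.

Lemma mean_dotZr (c : R) X Y : sq_integrable X -> sq_integrable Y ->
  mean_dot X (fun t => c *: Y t) = c * mean_dot X Y.
Proof.
move=> iX iY; rewrite /mean_dot -RintegralZl//; last exact: integrable_dotv.
by apply: eq_Rintegral => t _; rewrite dotvZr.
Qed.

Lemma mean_sqN X : mean_sq (fun t => - X t) = mean_sq X.
Proof. by apply: eq_Rintegral => t _; rewrite sqnormN. Qed.

End SquareIntegrable.

(** * Conditional expectation *)

Section ConditionalExpectation.
Context {disp : measure_display} {T : measurableType disp} {R : realType}.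
Variable P : probability T R.
Variable G : set (set T).
Hypothesis G_measurable : forall A, G A -> measurable A.

Lemma measurable_wrt_sub d' (U : measurableType d') (f : T -> U) :
  measurable_wrt G f -> measurable_fun [set: T] f.
Proof.
move=> mf _ B mB; have := mf measurableT B mB; apply.
by split; [exact: sigma_algebra_measurable|].
Qed.

Lemma is_condexp_ge0_integral (X Y : T -> \bar R) : is_condexp_ge0 P G X Y ->
  (\int[P]_t Y t = \int[P]_t X t)%E.
Proof. by move=> [_ _]; apply; exact: (@measurableT _ (g_sigma_algebraType G)). Qed.

(** Of a nonnegative variable, the conditional expectation of the negative part
    vanishes almost surely, so only the positive part remains. *)
Lemma is_condexp_le (X Y B : T -> \bar R) : (forall t, 0 <= X t)%E ->
  is_condexp P G X Y -> measurable_fun [set: T] B -> (forall t, 0 <= B t)%E ->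
  {ae P, forall t, (Y t <= B t)%E} -> (\int[P]_t X t <= \int[P]_t B t)%E.
Proof.
move=> X0 [_ [Yp [Yn [cYp cYn _ YE]]]] mB B0 YB.
have -> : (\int[P]_t X t = \int[P]_t Yp t)%E.
  rewrite (is_condexp_ge0_integral cYp); apply: eq_integral => t _.
  by rewrite (@ge0_funeposE _ _ setT) ?inE.
have Yn0 : ae_eq P setT Yn (cst 0%E).
  have [Yn0 mYn _] := cYn.
  apply/(ae_eq_integral_abs P measurableT (measurable_wrt_sub mYn)).
  under eq_integral => t _ do rewrite gee0_abs//.
  rewrite (is_condexp_ge0_integral cYn) integral0_eq// => t _.
  by rewrite (@ge0_funenegE _ _ setT) ?inE.
have [Yp0 mYp _] := cYp.
apply: ae_ge0_le_integral => //; first exact: measurable_wrt_sub.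
apply: filterS3 Yn0 YE YB => t h1 h2 h3 _.
by move: h3; rewrite h2 h1// sube0.
Qed.

(** The conditional expectations of the positive and the negative part have
    difference [0] almost everywhere, which in the extended reals forces both to
    be finite and equal there; so the two parts have the same mean. *)
Lemma is_condexp_zero (X : T -> R) :
  P.-integrable [set: T] (EFin \o X) ->
  is_condexp P G (EFin \o X) (cst 0%E) -> \int[P]_t X t = 0.
Proof.
move=> iX [_ [Yp [Yn [cYp cYn _ YE]]]].
rewrite /Rintegral integralE.
rewrite -(is_condexp_ge0_integral cYp) -(is_condexp_ge0_integral cYn).
have -> : (\int[P]_t Yp t = \int[P]_t Yn t)%E.
  case: cYp cYn => Yp0 mYp _ [Yn0 mYn _].
  apply: ge0_ae_eq_integral => //; try exact: measurable_wrt_sub.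
  apply: filterS YE => t /= + _.
  have := Yp0 t; have := Yn0 t; case: (Yp t) => [p| |]//; case: (Yn t) => [n| |]//.
  by move=> _ _ [] /esym /eqP; rewrite subr_eq0 => /eqP ->.
rewrite subee// (is_condexp_ge0_integral cYn).
have := integrable_fin_num measurableT (integrable_funeneg measurableT iX).
by [].
Qed.

End ConditionalExpectation.

(** * Gradient noise *)

Lemma outer_mulmx (R : realType) (M : nat) (a b : 'cV[R]_M) :
  (a *m a^T) *m b = dotv a b *: a.
Proof.
by rewrite -mulmxA (mx11_scalar (a^T *m b)) mul_mx_scalar.
Qed.

Lemma quadratic_growth_le (R : realType) (a b g s : R) :
  (forall c, c ^+ 2 * a + b <= c ^+ 2 * g + s) -> a <= g.
Proof.
move=> h; rewrite leNgt; apply/negP => ga.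
have ag : 0 < a - g by rewrite subr_gt0.
(* Here [c * (a - g)] exceeds [s - b], and [c <= c ^+ 2] as [1 <= c]. *)
pose c := `|s - b| / (a - g) + 1.
have c1 : 1 <= c by rewrite lerDr divr_ge0 ?normr_ge0// ltW.
have ca : c * (a - g) = `|s - b| + (a - g) by rewrite /c; field; rewrite gt_eqF.
have := h c; have := ler_norm (s - b).
have : c * (a - g) <= c ^+ 2 * (a - g).
  by rewrite ler_pM2r// expr2 ler_peMl// (le_trans _ c1).
lra.
Qed.

Section GradientNoise.
Context {disp : measure_display} {T : measurableType disp} {R : realType}.
Context {M : nat}.
Variable P : probability T R.
Variables (R_u : 'M[R]_M) (w_opt : 'cV[R]_M).
Variables (u : int -> T -> 'cV[R]_M) (v : int -> T -> R) (gamma sigma_s : R).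
Variables (i : int) (G : set (set T)).
Hypothesis G_measurable : forall A, G A -> measurable A.
Hypothesis u_meas : random_vector (u i).
Hypothesis v_meas : measurable_fun [set: T] (v i).
Hypothesis noise : noise_condition P R_u w_opt u v gamma sigma_s i G.

Definition adapted (X : T -> 'cV[R]_M) : Prop :=
  random_vector (X : g_sigma_algebraType G -> 'cV[R]_M).

(** The part of the gradient noise that is linear in the state. *)
Definition fluctuation (X : T -> 'cV[R]_M) (t : T) : 'cV[R]_M :=
  (R_u - u i t *m (u i t)^T) *m X t.

Definition measurement_noise (t : T) : 'cV[R]_M := v i t *: u i t.

Lemma grad_noiseE X t :
  grad_noise R_u w_opt u v i (fun t => w_opt - X t) t =
  fluctuation X t - measurement_noise t.
Proof. by rewrite /grad_noise opprB addrCA subrr addr0. Qed.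

Lemma fluctuationE X t :
  fluctuation X t = R_u *m X t - dotv (u i t) (X t) *: u i t.
Proof. by rewrite /fluctuation mulmxBl outer_mulmx. Qed.

Lemma adapted_random_vector X : adapted X -> random_vector X.
Proof. by move=> aX k; exact: (measurable_wrt_sub G_measurable (aX k)). Qed.

Lemma random_vector_fluctuation X : random_vector X ->
  random_vector (fluctuation X).
Proof.
move=> mX; rewrite (_ : fluctuation X = fun t => R_u *m X t - dotv (u i t) (X t) *: u i t).
  apply: random_vectorB; first exact: random_vector_mulmx.
  by apply: random_vectorZ => //; exact: measurable_dotv.
by apply/funext => t; rewrite fluctuationE.
Qed.

Lemma random_vector_measurement_noise : random_vector measurement_noise.
Proof. exact: random_vectorZ. Qed.

Lemma grad_noise_sq_integrable X : adapted X -> sq_integrable P X ->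
  sq_integrable P (fun t => fluctuation X t - measurement_noise t) /\
  mean_sq P (fun t => fluctuation X t - measurement_noise t)
    <= gamma ^+ 2 * mean_sq P X + sigma_s ^+ 2.
Proof.
move=> aX iX; set s := (fun t => _ - _).
have ms : random_vector s.
  apply: random_vectorB; last exact: random_vector_measurement_noise.
  exact: random_vector_fluctuation iX.1.
have ay k : measurable_wrt G (fun t => (w_opt - X t) k 0).
  have aw : adapted (fun t => w_opt - X t).
    by apply: random_vectorB => //; exact: random_vector_cst.
  exact: aw.
have [_ [S cS Sle]] := noise ay.
have iB : P.-integrable [set: T]
    (EFin \o (fun t => gamma ^+ 2 * sqnorm (X t) + sigma_s ^+ 2)).
  apply: integrable_add; first exact: integrable_scale iX.2.
  exact: finite_measure_integrable_cst.
have le : (\int[P]_t (sqnorm (s t))%:E <=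
    \int[P]_t (gamma ^+ 2 * sqnorm (X t) + sigma_s ^+ 2)%:E)%E.
  apply: (is_condexp_le G_measurable _ _ _ _ _ (Y := S)).
  - by move=> t; rewrite lee_fin sqnorm_ge0.
  - rewrite (_ : (fun t => _) = (fun t => (sqnorm (grad_noise R_u w_opt u v i
        (fun t => w_opt - X t) t))%:E)) //.
    by apply/funext => t; rewrite grad_noiseE.
  - exact: (measurable_int _ iB).
  - by move=> t; rewrite lee_fin addr_ge0 ?sqr_ge0// mulr_ge0 ?sqr_ge0 ?sqnorm_ge0.
  - by apply: filterS Sle => t; rewrite opprB addrCA subrr addr0.
have iint := integrable_fin_num measurableT iB.
have is_ : sq_integrable P s.
  apply: sq_integrableP => //; rewrite unlock (le_lt_trans le)// ltey_eq.
  by rewrite iint.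
split => //.
have -> : gamma ^+ 2 * mean_sq P X + sigma_s ^+ 2 =
    \int[P]_t (gamma ^+ 2 * sqnorm (X t) + sigma_s ^+ 2).
  rewrite RintegralD//; last 2 first.
  - exact: integrable_scale iX.2.
  - exact: finite_measure_integrable_cst.
  rewrite RintegralZl//; last exact: iX.2.
  by rewrite Rintegral_probability_cst.
by rewrite -lee_fin -expectation_sqnormE// unlock (le_trans le)// /Rintegral fineK.
Qed.

Lemma measurement_noise_sq_integrable :
  sq_integrable P measurement_noise /\
  mean_sq P measurement_noise <= sigma_s ^+ 2.
Proof.
have a0 : adapted (fun=> 0) by exact: random_vector_cst.
have [] := grad_noise_sq_integrable a0 (sq_integrable_cst P 0).
rewrite {2}/mean_sq; under [X in _ * X]eq_Rintegral do rewrite sqnorm0.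
rewrite Rintegral_probability_cst mulr0 add0r.
have -> : (fun t => fluctuation (fun=> 0) t - measurement_noise t) =
    (fun t => - measurement_noise t).
  by apply/funext => t; rewrite /fluctuation mulmx0 add0r.
move=> /sq_integrableN; under [X in sq_integrable _ X]eq_fun do rewrite opprK.
by rewrite mean_sqN.
Qed.

Lemma fluctuation_sq_integrable X : adapted X -> sq_integrable P X ->
  sq_integrable P (fluctuation X).
Proof.
move=> aX iX; have [is_ _] := grad_noise_sq_integrable aX iX.
have := sq_integrableD is_ measurement_noise_sq_integrable.1.
by under [X in sq_integrable _ X]eq_fun do rewrite subrK.
Qed.

(** The noise bound is affine in the squared distance to the minimizer, so
    evaluating it along a ray and letting the distance grow separates the part
    of the noise that is linear in the state from the measurement noise; the
    cross terms vanish when opposite points of the ray are averaged. *)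
Lemma fluctuation_mean_sq X : adapted X -> sq_integrable P X ->
  mean_sq P (fluctuation X) <= gamma ^+ 2 * mean_sq P X.
Proof.
move=> aX iX; have iF := fluctuation_sq_integrable aX iX.
have [iN _] := measurement_noise_sq_integrable.
have ray c : c ^+ 2 * mean_sq P (fluctuation X)
    - 2 * c * mean_dot P (fluctuation X) measurement_noise
    + mean_sq P measurement_noise
    <= c ^+ 2 * (gamma ^+ 2 * mean_sq P X) + sigma_s ^+ 2.
  have acX : adapted (fun t => c *: X t) by exact: random_vectorZc.
  have [_] := grad_noise_sq_integrable acX (sq_integrableZ c iX).
  rewrite mean_sqZ// (_ : (fun t => _ - _) =
      (fun t => c *: fluctuation X t + (-1) *: measurement_noise t)); last first.
    by apply/funext => t; rewrite /fluctuation -scalemxAr scaleN1r.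
  rewrite mean_sqD//; [|exact: sq_integrableZ..].
  rewrite !mean_sqZ// mean_dotZr//; last exact: sq_integrableZ.
  rewrite /mean_dot; under eq_Rintegral do rewrite dotvZl.
  by rewrite RintegralZl//; [lra|exact: integrable_dotv].
apply: (@quadratic_growth_le _ _ (mean_sq P measurement_noise) _ (sigma_s ^+ 2)) => c.
by have := ray c; have := ray (- c); rewrite sqrrN; lra.
Qed.

(** The condition constrains the noise at every adapted state, integrable or
    not, so an adapted factor [h] can be absorbed into the state: at the state
    [w_opt - h e_l] the conditionally centred noise is [h] times a column of
    the fluctuation, up to the measurement noise, which is the noise at
    [w_opt]. *)
Lemma fluctuation_entry_mean (h : T -> R) (k l : 'I_M) :
  measurable_wrt G h ->
  P.-integrable [set: T]
    (EFin \o (fun t => h t * (R_u - u i t *m (u i t)^T) k l)) ->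
  \int[P]_t (h t * (R_u - u i t *m (u i t)^T) k l) = 0.
Proof.
move=> mh ih.
have mean0 X : adapted X ->
    P.-integrable [set: T] (EFin \o (fun t => fluctuation X t k 0)) ->
    \int[P]_t fluctuation X t k 0 = \int[P]_t measurement_noise t k 0.
  move=> aX iX.
  have iN : P.-integrable [set: T] (EFin \o (fun t => measurement_noise t k 0)).
    under [X in EFin \o X]eq_fun do rewrite -dotv_delta_l.
    apply: integrable_dotv; first exact: sq_integrable_cst.
    exact: measurement_noise_sq_integrable.1.
  have ay j : measurable_wrt G (fun t => (w_opt - X t) j 0).
    have aw : adapted (fun t => w_opt - X t).
      by apply: random_vectorB => //; exact: random_vector_cst.
    exact: aw.
  have [/(_ k) c _] := noise ay.
  apply/eqP; rewrite -subr_eq0 -RintegralB//; apply/eqP.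
  apply: (is_condexp_zero G_measurable).
    exact: (integrableB measurableT iX iN).
  have -> : EFin \o (fun t => fluctuation X t k 0 - measurement_noise t k 0) =
     (fun t => (grad_noise R_u w_opt u v i (fun t => w_opt - X t) t k 0)%:E).
    apply/funext => t /=; rewrite grad_noiseE; congr EFin; rewrite [RHS]mxE.
    by congr (_ + _); rewrite [RHS]mxE.
  exact: c.
have FhE t : fluctuation (fun t => h t *: delta_mx l 0) t k 0 =
    h t * (R_u - u i t *m (u i t)^T) k l.
  by rewrite /fluctuation -scalemxAr -colE !mxE.
have F0E t : fluctuation (fun=> 0) t k 0 = 0 by rewrite /fluctuation mulmx0 mxE.
under eq_Rintegral => t _ do rewrite -FhE.
rewrite mean0.
- rewrite -(mean0 (fun=> 0)); last 2 first.
  + exact: random_vector_cst.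
  + under [X in EFin \o X]eq_fun do rewrite F0E.
    exact: finite_measure_integrable_cst.
  under eq_Rintegral => t _ do rewrite F0E.
  by rewrite Rintegral_probability_cst.
- apply: (@random_vectorZ _ (g_sigma_algebraType G) _ _ h _ mh).
  exact: random_vector_cst.
- by under [X in EFin \o X]eq_fun do rewrite FhE.
Qed.

(** Bilinearity of the pairing reduces this to the entries of the
    fluctuation matrix; isolating one coordinate of each vector by a
    diagonal matrix unit keeps every entry integrable. *)
Lemma fluctuation_orthogonal X Y : adapted X -> sq_integrable P X ->
  adapted Y -> sq_integrable P Y ->
  mean_dot P X (fluctuation Y) = 0.
Proof.
move=> aX iX aY iY.
pose h (k l : 'I_M) t := (X t k 0 * Y t l 0) * (R_u - u i t *m (u i t)^T) k l.
have hE k l t : h k l t =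
    dotv (delta_mx k k *m X t) (fluctuation (fun t => delta_mx l l *m Y t) t).
  rewrite dotv_mulmxl trmx_delta /fluctuation mulmxA -mulmxA.
  set N := (R_u - _).
  have E (j : 'I_M) (a : 'cV[R]_M) : delta_mx j j *m a = a j 0 *: delta_mx j 0.
    apply/matrixP => p q; rewrite ord1 !mxE (bigD1 j)//= big1 ?addr0.
      by rewrite !mxE !eqxx !andbT mulrC.
    by move=> r rj; rewrite !mxE (negbTE rj) andbF mul0r.
  rewrite (E l) -!scalemxAr dotvZr -colE (E k) dotvZr.
  by rewrite dotvC dotv_delta_l /h -/N !mxE; ring.
have ih k l : P.-integrable [set: T] (EFin \o h k l).
  rewrite (_ : h k l = fun t => dotv (delta_mx k k *m X t)
      (fluctuation (fun t => delta_mx l l *m Y t) t)); last first.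
    by apply/funext => t; rewrite hE.
  apply: integrable_dotv; first exact: sq_integrable_mulmx.
  apply: fluctuation_sq_integrable; last exact: sq_integrable_mulmx.
  exact: random_vector_mulmx.
have dE t : dotv (X t) (fluctuation Y t) = \sum_k \sum_l h k l t.
  rewrite dotvE; apply: eq_bigr => k _; rewrite /fluctuation mxE mulr_sumr.
  by apply: eq_bigr => l _; rewrite /h; ring.
rewrite /mean_dot; under eq_Rintegral => t _ do rewrite dE.
rewrite Rintegral_sum; last by move=> k; exact: integrable_sumr.
rewrite big1// => k _; rewrite Rintegral_sum// big1// => l _.
have mh : measurable_wrt G (fun t => X t k 0 * Y t l 0).
  by apply: measurable_funM; [exact: aX|exact: aY].
exact: fluctuation_entry_mean mh (ih k l).
Qed.

(** One step of a recursion whose drift is adapted: the fluctuation adds its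
    variance and no cross term. *)
Lemma mean_sq_drift_fluctuation X Y (c : R) :
  adapted X -> sq_integrable P X -> adapted Y -> sq_integrable P Y ->
  sq_integrable P (fun t => X t + c *: fluctuation Y t) /\
  mean_sq P (fun t => X t + c *: fluctuation Y t)
    <= mean_sq P X + c ^+ 2 * (gamma ^+ 2 * mean_sq P Y).
Proof.
move=> aX iX aY iY; have iF := fluctuation_sq_integrable aY iY.
split; first by apply: sq_integrableD => //; exact: sq_integrableZ.
rewrite mean_sqD//; last exact: sq_integrableZ.
rewrite mean_dotZr// fluctuation_orthogonal// mean_sqZ// !mulr0 addr0.
by rewrite lerD2l ler_wpM2l ?sqr_ge0// fluctuation_mean_sq.
Qed.

End GradientNoise.

(** * The Hessian of the mean-square-error risk *)

Section Hessian.
Context {R : realType} {M : nat}.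

(** The exact second order expansion of the increment makes the difference
    quotient affine in its parameter. *)
Lemma derive_of_increment (f : 'cV[R]_M -> R^o) (a v : 'cV[R]_M) (l q : R) :
  (forall h : R, f (h *: v + a) - f a = h * l + h ^+ 2 * q) -> 'D_v f a = l.
Proof.
move=> fE; apply: cvg_lim => //.
have : (fun h : R => l + h * q : R^o) @ 0^' --> (l : R^o).
  rewrite -[X in _ --> X]addr0 -[X in _ + X](mul0r q).
  apply: cvgD; first exact: cvg_cst.
  apply: cvgM; last exact: cvg_cst.
  exact: cvg_within.
apply: cvg_trans; apply: near_eq_cvg.
near=> h; rewrite /= /shift/= fE.
have h0 : h != 0 by near: h; exact: nbhs_dnbhs_neq.
by rewrite -[_ *: _]/(_ * _); field.
Unshelve. all: by end_near. Qed.

Lemma hessian_quadratic (f : 'cV[R]_M -> R) (c : R) (r : 'cV[R]_M) (A : 'M[R]_M) a :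
  A^T = A -> (forall b, f b = c - dotv r b + 2^-1 * dotv b (A *m b)) ->
  hessian f a = A.
Proof.
move=> AT fE; apply/matrixP => k l; rewrite mxE.
have D1 b : 'D_(delta_mx l 0) (f : 'cV[R]_M -> R^o) b
    = dotv (delta_mx l 0) (A *m b) - r l 0.
  apply: (@derive_of_increment _ _ _ _ (2^-1 * A l l)) => h.
  rewrite !fE !dotvDr !dotvZr mulmxDr -scalemxAr !dotvDl !dotvDr !dotvZl !dotvZr.
  rewrite (dotvC b (A *m delta_mx l 0)) dotv_mulmxl AT.
  rewrite !dotv_delta_l -colE !mxE (dotvC r) dotv_delta_l; by field.
rewrite (funext D1).
apply: (@derive_of_increment _ _ _ _ 0) => h.
rewrite mulmxDr -scalemxAr dotvDr dotvZr !dotv_delta_l -colE !mxE.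
by rewrite -[in A l k]AT mxE; ring.
Qed.

End Hessian.

Section Risk.
Context {disp : measure_display} {T : measurableType disp} {R : realType}.
Context {M : nat}.
Variable P : probability T R.

Lemma integrable_of_expectation (f : T -> R) : (forall t, 0 <= f t) ->
  measurable_fun [set: T] f -> ('E_P[f] < +oo)%E ->
  P.-integrable [set: T] (EFin \o f).
Proof.
rewrite unlock => f0 mf lf; apply/integrableP; split; first exact/measurable_EFinP.
apply: le_lt_trans lf; rewrite le_eqVlt; apply/orP; left; apply/eqP.
by apply: eq_integral => t _ /=; rewrite ger0_norm.
Qed.

(** Square integrability of [d] and [u] lets the expectation be expanded, which
    makes the risk a quadratic polynomial. *)
Lemma hessian_mse_risk (d : T -> R) (u : T -> 'cV[R]_M) (R_u : 'M[R]_M) w :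
  measurable_fun [set: T] d -> random_vector u ->
  ('E_P[fun t => (d t ^+ 2)%R] < +oo)%E ->
  (forall k l, 'E_P[fun t => ((u t *m (u t)^T) k l)%R] = (R_u k l)%:E)%E ->
  hessian (mse_risk P d u) w = R_u.
Proof.
move=> md mu d2 cov.
have uuE k l t : (u t *m (u t)^T) k l = u t k 0 * u t l 0.
  by rewrite !mxE big_ord1 mxE.
have id2 : P.-integrable [set: T] (EFin \o (fun t => d t ^+ 2)).
  apply: integrable_of_expectation => [t||//]; first exact: sqr_ge0.
  exact: measurable_funX.
have iu2 k : P.-integrable [set: T] (EFin \o (fun t => u t k 0 ^+ 2)).
  apply: integrable_of_expectation => [t||]; first exact: sqr_ge0.
    exact: measurable_funX.
  rewrite (_ : (fun t => _) = (fun t => (u t *m (u t)^T) k k)); first by rewrite cov ltry.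
  by apply/funext => t; rewrite uuE expr2.
have iprod (f g : T -> R) : measurable_fun [set: T] f -> measurable_fun [set: T] g ->
    P.-integrable [set: T] (EFin \o (fun t => f t ^+ 2)) ->
    P.-integrable [set: T] (EFin \o (fun t => g t ^+ 2)) ->
    P.-integrable [set: T] (EFin \o (fun t => f t * g t)).
  move=> mf mg f2 g2; apply: integrable_le (integrable_add f2 g2) _.
    exact: measurable_funM.
  move=> t /=; rewrite normrM -(real_normK (num_real (f t))) -(real_normK (num_real (g t))).
  have := normr_ge0 (f t); have := normr_ge0 (g t).
  by have := sqr_ge0 (`|f t| - `|g t|); nra.
have idu k := iprod d _ md (mu k) id2 (iu2 k).
have iuu k l := iprod _ _ (mu k) (mu l) (iu2 k) (iu2 l).
have RE k l : \int[P]_t (u t k 0 * u t l 0) = R_u k l.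
  have := cov k l; rewrite unlock /Rintegral => cE.
  by under eq_integral do rewrite -uuE; rewrite cE.
pose r : 'cV[R]_M := \col_k \int[P]_t (d t * u t k 0).
apply: (@hessian_quadratic _ _ _ (2^-1 * \int[P]_t (d t ^+ 2)) r).
  apply/matrixP => k l; rewrite mxE -!RE.
  by apply: eq_Rintegral => t _; rewrite mulrC.
move=> b.
have sqE t : (d t - dotv (u t) b) ^+ 2 =
    d t ^+ 2 + (\sum_k (- 2 * b k 0) * (d t * u t k 0)
       + \sum_k \sum_l (b k 0 * b l 0) * (u t k 0 * u t l 0)).
  have -> : \sum_k (- 2 * b k 0) * (d t * u t k 0) = - 2 * d t * dotv (u t) b.
    by rewrite dotvE mulr_sumr; apply: eq_bigr => k _; ring.
  have -> : \sum_k \sum_l (b k 0 * b l 0) * (u t k 0 * u t l 0) = dotv (u t) b ^+ 2.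
    rewrite dotvE expr2 mulr_suml; apply: eq_bigr => k _.
    by rewrite mulr_sumr; apply: eq_bigr => l _; ring.
  ring.
rewrite /mse_risk unlock.
rewrite -[fine _]/(\int[P]_t ((d t - dotv (u t) b) ^+ 2)).
under eq_Rintegral => t _ do rewrite sqE.
have i1 : P.-integrable [set: T] (EFin \o (fun t => \sum_k (- 2 * b k 0) * (d t * u t k 0))).
  by apply: integrable_sumr => k; exact: integrable_scale.
have i2 k : P.-integrable [set: T]
    (EFin \o (fun t => \sum_l (b k 0 * b l 0) * (u t k 0 * u t l 0))).
  by apply: integrable_sumr => l; exact: integrable_scale.
have i3 : P.-integrable [set: T]
    (EFin \o (fun t => \sum_k \sum_l (b k 0 * b l 0) * (u t k 0 * u t l 0))).
  exact: integrable_sumr.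
rewrite RintegralD//; last exact: integrable_add.
rewrite RintegralD//.
rewrite (@Rintegral_sum _ _ _ P _ _ (fun k t => (- 2 * b k 0) * (d t * u t k 0))); last first.
  by move=> k; exact: integrable_scale.
rewrite (@Rintegral_sum _ _ _ P _ _ (fun k t => \sum_l (b k 0 * b l 0) * (u t k 0 * u t l 0)))//.
have -> : \sum_k \int[P]_t ((- 2 * b k 0) * (d t * u t k 0)) = - 2 * dotv r b.
  rewrite dotvE mulr_sumr; apply: eq_bigr => k _.
  by rewrite RintegralZl// mxE; ring.
have -> : \sum_k \int[P]_t (\sum_l (b k 0 * b l 0) * (u t k 0 * u t l 0))
    = dotv b (R_u *m b).
  rewrite dotvE; apply: eq_bigr => k _.
  rewrite (@Rintegral_sum _ _ _ P _ _ (fun l t => (b k 0 * b l 0) * (u t k 0 * u t l 0))).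
    rewrite mxE mulr_sumr; apply: eq_bigr => l _.
    by rewrite RintegralZl// RE; ring.
  by move=> l; exact: integrable_scale.
by field.
Qed.

End Risk.

(** * One step of the recursions in mean square *)

Section OneStep.
Context {disp : measure_display} {T : measurableType disp} {R : realType}.
Context {M : nat}.
Variable P : probability T R.
Variables (R_u : 'M[R]_M) (w_opt : 'cV[R]_M).
Variables (u : int -> T -> 'cV[R]_M) (v : int -> T -> R) (gamma sigma_s : R).
Variables (i : int) (G : set (set T)).
Hypothesis G_measurable : forall A, G A -> measurable A.
Hypothesis u_meas : random_vector (u i).
Hypothesis v_meas : measurable_fun [set: T] (v i).
Hypothesis noise : noise_condition P R_u w_opt u v gamma sigma_s i G.
Variables (nu r mu : R).
Hypotheses (nu0 : 0 < nu) (mu0 : 0 < mu) (mu1 : mu <= 1) (munu : mu * nu <= 1).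
Hypothesis nuR : loewner_le nu%:M R_u.
Hypotheses (r0 : 0 <= r) (rR : forall b, sqnorm (R_u *m b) <= r * sqnorm b).
Hypothesis mur : mu * (2 * r + 2 * gamma ^+ 2) <= nu / 2.

Let fl := fluctuation R_u u i.
Let n := measurement_noise u v i.

(** Per unit of [mu], the weight of the velocity in the mean square of a step
    whose gradient is read at a point displaced by [kap] times the velocity. *)
Definition drift_rate (kap : R) : R :=
  kap ^+ 2 * ((1 + 4 / nu) * r + 2 * gamma ^+ 2).

Lemma drift_rate_ge0 kap : 0 <= drift_rate kap.
Proof.
have h : 0 <= 1 + 4 / nu by rewrite addr_ge0// divr_ge0// ltW.
by rewrite mulr_ge0 ?sqr_ge0// addr_ge0 ?(mulr_ge0 h r0)// mulr_ge0// sqr_ge0.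
Qed.

(* Parameter of Young's inequality that costs a quarter of the rate [mu * nu]. *)
Let s := mu * nu / 4.
Let s0 : 0 < s. Proof. by rewrite !mulr_gt0. Qed.
Let sV : (1 + s^-1) * mu ^+ 2 <= mu * (1 + 4 / nu).
Proof.
have -> : (1 + s^-1) * mu ^+ 2 = mu * (mu + 4 / nu).
  by rewrite /s; field; rewrite !gt_eqF.
by rewrite ler_pM2l// lerD2r.
Qed.

(** A gradient step from [a] whose gradient is read at a displaced point. The
    deterministic part contracts at rate [2 mu nu]; the displacement enters
    through Young's inequality with weight of order [1 / (mu nu)], which its
    factor [mu ^+ 2] brings down to order [mu]; the fluctuation is orthogonal
    and of second order. The slack left by [5 / 4] absorbs the measurement
    noise in the next lemma. *)
Lemma mean_sq_gradient_step (kap : R) (a m : T -> 'cV[R]_M) :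
  adapted G a -> sq_integrable P a -> adapted G m -> sq_integrable P m ->
  let p t := a t + kap *: m t in
  let a' t := a t - mu *: (R_u *m p t) + mu *: fl p t in
  sq_integrable P a' /\
  mean_sq P a' <= (1 - 5 / 4 * (mu * nu)) * mean_sq P a
                  + drift_rate kap * mu * mean_sq P m.
Proof.
move=> aa ia am im p a'.
have ap : adapted G p by apply: random_vectorD => //; exact: random_vectorZc.
have ip : sq_integrable P p by apply: sq_integrableD => //; exact: sq_integrableZ.
pose b t := a t - mu *: (R_u *m p t).
have ab : adapted G b.
  apply: random_vectorB => //; apply: random_vectorZc.
  exact: random_vector_mulmx.
have mb := adapted_random_vector G_measurable ab.
have mp := adapted_random_vector G_measurable ap.
have [ib bb] : sq_integrable P b /\ mean_sq P b <=
    ((1 + s) * (1 - 2 * mu * nu + mu ^+ 2 * r)) * mean_sq P a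
    + ((1 + s^-1) * (mu ^+ 2 * (kap ^+ 2 * r))) * mean_sq P m.
  apply: mean_sq_le => // t; rewrite /b.
  have -> : a t - mu *: (R_u *m p t) =
      (a t - mu *: (R_u *m a t)) + (- (mu * kap)) *: (R_u *m m t).
    by rewrite /p mulmxDr -scalemxAr scalerDr scalerA scaleNr opprD addrA.
  apply: le_trans (sqnormD_young _ _ s0) _.
  have h1 := sqnorm_gradient_step (a t) (ltW mu0) nuR rR.
  have k0 : 0 <= mu ^+ 2 * kap ^+ 2 by rewrite mulr_ge0// sqr_ge0.
  have h2 := ler_wpM2l k0 (rR (m t)).
  have s1 : 0 <= 1 + s by rewrite addr_ge0// ltW.
  have s2 : 0 <= 1 + s^-1 by rewrite addr_ge0// invr_ge0 ltW.
  have h3 := ler_wpM2l s1 h1; have h4 := ler_wpM2l s2 h2.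
  by rewrite sqnormZ sqrrN exprMn; lra.
have [_ pb] : sq_integrable P p /\
    mean_sq P p <= 2 * mean_sq P a + (2 * kap ^+ 2) * mean_sq P m.
  apply: mean_sq_le => // t.
  rewrite /p; have := sqnormD2 (a t) (kap *: m t).
  by rewrite sqnormZ mulrA.
have [ia' ba'] := mean_sq_drift_fluctuation G_measurable u_meas v_meas noise mu ab ib ap ip.
split=> //; apply: le_trans ba' _.
have Za := mean_sq_ge0 P a; have Zm := mean_sq_ge0 P m.
have g0 := sqr_ge0 gamma; have k0 := sqr_ge0 kap.
have m2 : 0 <= mu ^+ 2 by exact: sqr_ge0.
have c1 : mu ^+ 2 * (gamma ^+ 2 * mean_sq P p) <=
   (2 * (mu ^+ 2 * gamma ^+ 2)) * mean_sq P a
     + (2 * (mu ^+ 2 * gamma ^+ 2) * kap ^+ 2) * mean_sq P m.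
  have := ler_wpM2l (mulr_ge0 m2 g0) pb; lra.
have mm : mu ^+ 2 <= mu by rewrite expr2 ler_piMr// ltW.
have c2 : (1 + s) * (1 - 2 * mu * nu + mu ^+ 2 * r) + 2 * (mu ^+ 2 * gamma ^+ 2)
    <= 1 - 5 / 4 * (mu * nu).
  have h1 := ler_wpM2l (ltW mu0) mur.
  have s1 : s <= 1 / 4 by rewrite ler_pM2r ?invr_gt0.
  have h2 : (1 + s) * (mu ^+ 2 * r) <= 2 * (mu ^+ 2 * r).
    by apply: ler_wpM2r; [rewrite mulr_ge0|lra].
  have h3 : (1 + s) * (1 - 2 * mu * nu) <= 1 - 7 / 4 * (mu * nu).
    have : 0 <= (mu * nu) ^+ 2 by exact: sqr_ge0.
    rewrite /s; lra.
  have e : mu * (mu * (2 * r + 2 * gamma ^+ 2)) =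
     2 * (mu ^+ 2 * r) + 2 * (mu ^+ 2 * gamma ^+ 2) by ring.
  by move: h1; rewrite e; lra.
have c3 : (1 + s^-1) * (mu ^+ 2 * (kap ^+ 2 * r)) + 2 * (mu ^+ 2 * gamma ^+ 2) * kap ^+ 2
    <= drift_rate kap * mu.
  have h1 := ler_wpM2r (mulr_ge0 k0 r0) sV.
  have h2 := ler_wpM2r (mulr_ge0 g0 k0) mm.
  by rewrite /drift_rate; lra.
by have := ler_wpM2r Za c2; have := ler_wpM2r Zm c3; lra.
Qed.

(** Bounding the measurement noise by Young's inequality ignores that it is
    centred, which costs a factor [1 / mu] compared with the sharp variance; the
    resulting error of order [1] is enough, as it only feeds the velocity. *)
Lemma mean_sq_noisy_gradient_step (kap : R) (a m : T -> 'cV[R]_M) :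
  adapted G a -> sq_integrable P a -> adapted G m -> sq_integrable P m ->
  let p t := a t + kap *: m t in
  let a' t := a t - mu *: (R_u *m p t) + mu *: fl p t - mu *: n t in
  sq_integrable P a' /\
  mean_sq P a' <= (1 - mu * nu) * mean_sq P a
    + 2 * drift_rate kap * mu * mean_sq P m + (1 + 4 / nu) * mu * sigma_s ^+ 2.
Proof.
move=> aa ia am im p a'.
have [ib bb] := mean_sq_gradient_step kap aa ia am im.
set b := (fun t => _) in ib bb.
have [in_ bn] := measurement_noise_sq_integrable G_measurable u_meas v_meas noise.
have [ia' ba'] : sq_integrable P a' /\ mean_sq P a' <=
    (1 + s) * mean_sq P b + ((1 + s^-1) * mu ^+ 2) * mean_sq P n.
  apply: mean_sq_le => // [|t].
    apply: random_vectorB; first exact: ib.1.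
    exact: random_vectorZc in_.1.
  apply: le_trans (sqnormD_young _ _ s0) _.
  by rewrite sqnormN sqnormZ mulrA.
split => //; apply: le_trans ba' _.
have Za := mean_sq_ge0 P a; have Zm := mean_sq_ge0 P m; have Zn := mean_sq_ge0 P n.
have dm0 : 0 <= drift_rate kap * mu * mean_sq P m.
  exact: mulr_ge0 (mulr_ge0 (drift_rate_ge0 kap) (ltW mu0)) Zm.
have s1 : s <= 1 / 4 by rewrite ler_pM2r ?invr_gt0.
have h1 := ler_wpM2l (addr_ge0 ler01 (ltW s0)) bb.
have h2 : (1 + s) * (1 - 5 / 4 * (mu * nu)) <= 1 - mu * nu.
  have : 0 <= (mu * nu) ^+ 2 by exact: sqr_ge0.
  rewrite /s; lra.
have h3 := ler_wpM2r Za h2.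
have h4 : (1 + s) * (drift_rate kap * mu * mean_sq P m) <=
    2 * (drift_rate kap * mu * mean_sq P m) by apply: ler_wpM2r => //; lra.
have h5 := ler_wpM2r Zn sV.
have h6 : mu * (1 + 4 / nu) * mean_sq P n <= mu * (1 + 4 / nu) * sigma_s ^+ 2.
  by apply: ler_wpM2l => //; rewrite mulr_ge0 ?addr_ge0 ?divr_ge0// ltW.
by lra.
Qed.

(** The velocity averages its past with a gradient scaled by [mu], so convexity
    of the squared norm yields a factor [mu ^+ 2]. *)
Lemma mean_sq_momentum_step (beta kap : R) (a m : T -> 'cV[R]_M) : 0 <= beta < 1 ->
  adapted G a -> sq_integrable P a -> adapted G m -> sq_integrable P m ->
  let p t := a t + kap *: m t in
  let m' t := beta *: m t + ((1 - beta) * mu) *: (R_u *m p t - fl p t + n t) in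
  sq_integrable P m' /\
  mean_sq P m' <= beta * mean_sq P m
    + mu ^+ 2 * ((4 * r + 4 * gamma ^+ 2) * (mean_sq P a + kap ^+ 2 * mean_sq P m)
                 + 2 * sigma_s ^+ 2).
Proof.
move=> /andP[b0 b1] aa ia am im p m'.
have ap : adapted G p by apply: random_vectorD => //; exact: random_vectorZc.
have ip : sq_integrable P p by apply: sq_integrableD => //; exact: sq_integrableZ.
have [_ pb] : sq_integrable P p /\
    mean_sq P p <= 2 * mean_sq P a + (2 * kap ^+ 2) * mean_sq P m.
  apply: mean_sq_le => // [|t]; first exact: ip.1.
  by rewrite /p; have := sqnormD2 (a t) (kap *: m t); rewrite sqnormZ mulrA.
have [ig bg] := grad_noise_sq_integrable G_measurable u_meas v_meas noise ap ip.
set g := (fun t => _ - _) in ig bg.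
pose h t := R_u *m p t - fl p t + n t.
have hE t : h t = R_u *m p t - g t by rewrite /h /g opprB [RHS]addrA [RHS]addrAC.
have mh : random_vector h.
  rewrite (funext hE); apply: random_vectorB; last exact: ig.1.
  exact: random_vector_mulmx ip.1.
have [ih bh] : sq_integrable P h /\ mean_sq P h <=
    (2 * r) * mean_sq P p + 2 * mean_sq P g.
  apply: mean_sq_le => // t; rewrite hE; apply: le_trans (sqnormD2 _ _) _.
  by rewrite sqnormN -mulrA lerD2r ler_pM2l.
have [im' bm'] : sq_integrable P m' /\ mean_sq P m' <=
    beta * mean_sq P m + ((1 - beta) * mu ^+ 2) * mean_sq P h.
  apply: mean_sq_le => // [|t].
    by apply: random_vectorD; apply: random_vectorZc => //; exact: im.1.
  rewrite /m' -scalerA -/(h t).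
  have bb : 0 <= beta < 1 by rewrite b0.
  apply: le_trans (sqnorm_convex _ _ bb) _.
  by rewrite sqnormZ [in leLHS]mulrA.
split => //; apply: le_trans bm' _; rewrite lerD2l.
have h0 := mean_sq_ge0 P h.
have : ((1 - beta) * mu ^+ 2) * mean_sq P h <= mu ^+ 2 * mean_sq P h.
  apply: ler_wpM2r => //; rewrite ler_piMl ?sqr_ge0//; lra.
move=> /le_trans; apply; rewrite ler_wpM2l ?sqr_ge0//.
apply: le_trans bh _.
have h1 : r * mean_sq P p <= r * (2 * mean_sq P a + (2 * kap ^+ 2) * mean_sq P m).
  exact: ler_wpM2l.
have h2 := ler_wpM2l (sqr_ge0 gamma) pb.
by lra.
Qed.

End OneStep.

(** * Three coupled scalar recursions *)

Section CoupledRecursion.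
Context {R : realFieldType}.

(** The three sequences stand for the error, the velocity and the gap. Since
    [beta < 1] is fixed, for small [mu] the velocity contracts faster than
    [rho]; this makes [Z + Q] a Lyapunov function, and lets [Q] follow the
    forcing [mu ^+ 2 * Z] without resonance. The gap in turn is forced by [Q] at
    its own rate [rho], whence the factor [k]. The thresholds on [mu] make each
    perturbation of a rate at most half of its margin. *)
Lemma coupled_recursion_bound (nu beta c v : R) :
    0 < nu -> 0 <= beta < 1 -> 0 < c -> 0 <= v ->
  exists mu_bar C : R, [/\ 0 < mu_bar, mu_bar <= 1, 0 <= C &
    forall mu s : R, 0 < mu < mu_bar -> 0 <= s ->
    let rho := 1 - mu * nu / 2 in
    0 < rho < 1 /\
    forall Z Q E : nat -> R,
      (forall k, 0 <= Z k) -> (forall k, 0 <= Q k) -> (forall k, 0 <= E k) ->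
      Z 0 <= v -> Q 0 <= v * mu ^+ 2 -> E 0 <= v * mu ^+ 2 ->
      (forall k, Z k.+1 <= (1 - mu * nu) * Z k + c * mu * Q k + c * mu * s) ->
      (forall k, Q k.+1 <= (beta + c * mu ^+ 2) * Q k + c * mu ^+ 2 * (Z k + s)) ->
      (forall k, E k.+1 <= (1 - mu * nu) * E k + c * mu * Q k) ->
      forall k, E k + Q k <=
        C * ((rho ^+ k + s) * mu ^+ 2 + k%:R * rho ^+ k * mu ^+ 3)].
Proof.
move=> nu0 /andP[b0 b1] c0 v0.
have ob0 : 0 < 1 - beta by rewrite subr_gt0.
pose C1 := 2 * v + 4 * c / nu.
pose D := v + 2 * c * (C1 + 1) / (1 - beta).
pose F := 2 * c * D / nu.
pose G := 2 * c * D.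
have C10 : 0 <= C1 by rewrite addr_ge0 ?mulr_ge0 ?invr_ge0// ltW.
have DE : D * (1 - beta) / 2 = v * (1 - beta) / 2 + c * (C1 + 1).
  by rewrite /D; field; rewrite gt_eqF.
have vD : v <= D.
  by rewrite lerDl divr_ge0 ?(ltW ob0)// !mulr_ge0 ?(ltW c0)// addr_ge0.
have D0 := le_trans v0 vD.
have G0 : 0 <= G by rewrite /G !mulr_ge0// ltW.
have F0 : 0 <= F by rewrite /F divr_ge0 ?(ltW nu0)// !mulr_ge0// ltW.
have FE : F * nu = 2 * c * D by rewrite /F; field; rewrite gt_eqF.
have c2 : 0 < 2 * c by rewrite mulr_gt0.
have c4 : 0 < 4 * c + nu by rewrite addr_gt0 ?mulr_gt0.
exists (Num.min (Num.min 1 nu^-1) (Num.min (nu / (2 * c)) ((1 - beta) / (4 * c + nu)))).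
exists (v + F + G + D); split.
- by rewrite !lt_min ltr01 invr_gt0 nu0 (divr_gt0 nu0 c2) (divr_gt0 ob0 c4).
- by rewrite !ge_min lexx.
- by apply: addr_ge0 => //; apply: addr_ge0 => //; apply: addr_ge0.
move=> mu s /andP[mu0]; rewrite !lt_min => /andP[/andP[mu1 munu] /andP[muc mub]] s0 rho.
have h1 : mu * nu < 1 by rewrite -ltr_pdivlMr// mul1r.
have h2 : mu * (2 * c) < nu by rewrite -ltr_pdivlMr.
have h3 : mu * (4 * c + nu) < 1 - beta.
  by rewrite -ltr_pdivlMr.
have mn0 : 0 < mu * nu by rewrite mulr_gt0.
have cm0 : 0 < c * mu by rewrite mulr_gt0.
have cmm : c * mu ^+ 2 <= c * mu by rewrite ler_pM2l// expr2 ler_piMr// ltW.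
have cmn : c * mu ^+ 2 <= mu * nu / 2.
  have -> : c * mu ^+ 2 = mu * (mu * (2 * c)) / 2 by rewrite expr2; field.
  by rewrite ler_pM2r ?invr_gt0// ler_pM2l// ltW.
have rho12 : 2^-1 <= rho by rewrite /rho; lra.
have rho1 : rho < 1 by rewrite /rho; lra.
have rho0 : 0 < rho by lra.
have rhob : (1 - beta) / 2 <= rho - (beta + c * mu ^+ 2) by rewrite /rho; lra.
split; first by rewrite rho0 rho1.
move=> Z Q E Z0 Q0 E0 Zi Qi Ei Zs Qs Es.
have rk0 k : 0 < rho ^+ k by rewrite exprn_gt0.
have m20 : 0 < mu ^+ 2 by rewrite exprn_gt0.
(* The weight of one step of noise, summed geometrically: 2 c mu / (1 - rho). *)
have V k : Z k + Q k <= C1 * (rho ^+ k + s).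
  suff : Z k + Q k <= 2 * v * rho ^+ k + 4 * c / nu * s.
    have := mulr_ge0 v0 s0.
    have : 0 <= 4 * c / nu * rho ^+ k by rewrite !mulr_ge0 ?invr_ge0// ltW.
    by rewrite /C1; nra.
  elim: k => [|k IH].
    rewrite expr0 mulr1; have : 0 <= 4 * c / nu * s by rewrite !mulr_ge0 ?invr_ge0// ltW.
    have : v * mu ^+ 2 <= v by rewrite ler_piMr// expr_le1// ltW.
    by have := Zi; have := Qi; lra.
  have st : Z k.+1 + Q k.+1 <= rho * (Z k + Q k) + 2 * c * mu * s.
    have a1 : c * mu ^+ 2 * Z k <= mu * nu / 2 * Z k by apply: ler_wpM2r.
    have a2 : (c * mu + beta + c * mu ^+ 2) * Q k <= rho * Q k.
      by apply: ler_wpM2r => //; rewrite /rho; lra.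
    have a3 : c * mu ^+ 2 * s <= c * mu * s by apply: ler_wpM2r.
    have := Zs k; have := Qs k; rewrite /rho in a2 *; lra.
  have IH' := ler_wpM2l (ltW rho0) IH.
  have e1 : 4 * c / nu * s - rho * (4 * c / nu * s) = 2 * c * mu * s.
    by rewrite /rho; field; rewrite gt_eqF.
  by rewrite (exprS rho); lra.
(* [D] is chosen so that the fixed margin [(1 - beta) / 2] between the two rates
   dominates the forcing by [Z]. *)
have QB k : Q k <= D * mu ^+ 2 * (rho ^+ k + s).
  elim: k => [|k IH].
    rewrite expr0; have h := ler_wpM2r (ltW m20) vD.
    have : 0 <= D * mu ^+ 2 * s by rewrite !mulr_ge0// ltW.
    by lra.
  have bb0 : 0 <= beta + c * mu ^+ 2 by rewrite addr_ge0// mulr_ge0// ltW.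
  have a1 := ler_wpM2l bb0 IH.
  have a2 : c * mu ^+ 2 * (Z k + s) <= c * mu ^+ 2 * ((C1 + 1) * (rho ^+ k + s)).
    apply: ler_wpM2l; first by rewrite mulr_ge0// ltW.
    by have := V k; have := Q0 k; have := ltW (rk0 k); lra.
  have w0 : 0 <= mu ^+ 2 * (rho ^+ k + s) by rewrite mulr_ge0 ?addr_ge0// ltW.
  have a3 : ((beta + c * mu ^+ 2) * D + c * (C1 + 1)) * (mu ^+ 2 * (rho ^+ k + s))
      <= (rho * D) * (mu ^+ 2 * (rho ^+ k + s)).
    apply: ler_wpM2r => //; have := ler_wpM2r D0 rhob.
    have : 0 <= v * (1 - beta) / 2 by rewrite !mulr_ge0// ltW.
    by have := DE; lra.
  have a4 : D * mu ^+ 2 * (rho * s) <= D * mu ^+ 2 * s.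
    by apply: ler_wpM2l; [rewrite mulr_ge0// ltW|rewrite ler_piMl// ltW].
  by have := Qs k; rewrite (exprS rho); lra.
(* Forcing [rho ^+ k] against decay [rho ^+ k.+1] loses a factor [rho^-1 <= 2],
   which accounts for the [2] in [G]. *)
have EB k : E k <= (v * rho ^+ k + F * s) * mu ^+ 2 + G * (k%:R * rho ^+ k * mu ^+ 3).
  elim: k => [|k IH].
    rewrite expr0 !mul0r mulr0 addr0 mulr1.
    have : 0 <= F * s * mu ^+ 2 by apply: mulr_ge0; [exact: mulr_ge0|exact: ltW].
    by lra.
  have a1 := ler_wpM2l (ltW cm0) (QB k).
  have a2 := ler_wpM2l (ltW rho0) IH.
  have a3 : (1 - mu * nu) * E k <= rho * E k by apply: ler_wpM2r => //; rewrite /rho; lra.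
  have a4 : c * mu * (D * mu ^+ 2 * rho ^+ k) <= G * (rho * rho ^+ k * mu ^+ 3).
    have e : c * mu * (D * mu ^+ 2 * rho ^+ k) = (c * D * mu ^+ 3 * rho ^+ k) * 1 by ring.
    have -> : G * (rho * rho ^+ k * mu ^+ 3) = (c * D * mu ^+ 3 * rho ^+ k) * (2 * rho).
      by rewrite /G; ring.
    rewrite e; apply: ler_wpM2l; last lra.
    by rewrite !mulr_ge0 ?exprn_ge0// ltW.
  have e5 : F * s * mu ^+ 2 - rho * (F * s * mu ^+ 2) = c * mu * (D * mu ^+ 2 * s).
    have -> : F * s * mu ^+ 2 - rho * (F * s * mu ^+ 2) = (F * nu) * (s * mu ^+ 3) / 2.
      by rewrite /rho; field.
    by rewrite FE; field.
  have := Es k; rewrite -[k.+1]addn1 natrD mulrDl (exprD rho) expr1.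
  lra.
move=> k.
have p1 : 0 <= k%:R * rho ^+ k * mu ^+ 3 by rewrite !mulr_ge0 ?exprn_ge0// ltW.
have p2 : 0 <= rho ^+ k * mu ^+ 2 by rewrite mulr_ge0// ltW.
have p3 : 0 <= s * mu ^+ 2 by rewrite mulr_ge0// ltW.
have := EB k; have := QB k.
have := mulr_ge0 v0 p1; have := mulr_ge0 F0 p1; have := mulr_ge0 D0 p1.
have := mulr_ge0 F0 p2; have := mulr_ge0 G0 p2.
have := mulr_ge0 v0 p3; have := mulr_ge0 G0 p3.
lra.
Qed.

End CoupledRecursion.

(** * Trajectories of LMS and momentum LMS *)

Lemma data_times_nat (k : nat) : data_times k.
Proof. by rewrite /data_times /mkset (@le_trans _ _ 0). Qed.

Section Histories.
Context {disp : measure_display} {T : measurableType disp} {R : realType}.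
Context {M : nat}.

Lemma vec_events_measurable (X : T -> 'cV[R]_M) : random_vector X ->
  forall A, vec_events X A -> measurable A.
Proof. by move=> mX A [k _ [B mB <-]]; exact: mX. Qed.

Lemma adapted_of_events (G : set (set T)) (X : T -> 'cV[R]_M) :
  (forall A, vec_events X A -> G A) -> adapted G X.
Proof.
move=> XG k _ B mB; apply: sub_gen_smallest; apply: XG.
by exists k => //; exists B.
Qed.

Lemma history_measurable (x w psi : int -> T -> 'cV[R]_M) (i : int) :
  (forall j, -1 <= j <= i -> random_vector (x j)) ->
  (forall j, -2 <= j <= i -> random_vector (w j) /\ random_vector (psi j)) ->
  forall A, history x w psi i A -> measurable A.
Proof.
move=> mx mwpsi A [[j ji]|[j ji [|]]]; apply: vec_events_measurable.
- exact: mx.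
- exact: (mwpsi j ji).1.
- exact: (mwpsi j ji).2.
Qed.

End Histories.

Lemma nonneg_sum_bounds (R : realFieldType) (a b e f : R) :
  0 <= a -> 0 <= b -> 0 <= e -> 0 <= f ->
  let c := 2 * a + (1 + b) + (f + e) + 2 in
  [/\ 2 * a <= c, 1 + b <= c, f <= c, e <= c & 2 <= c].
Proof. by move=> a0 b0 e0 f0 c; rewrite /c; split; lra. Qed.

Section Trajectories.
Context {disp : measure_display} {T : measurableType disp} {R : realType}.
Context {M : nat}.
Variables (d v : int -> T -> R) (u : int -> T -> 'cV[R]_M).
Variables (R_u : 'M[R]_M) (w_opt : 'cV[R]_M).
Hypothesis linear_model : forall i t, data_times i ->
  d i t = dotv (u i t) w_opt + v i t.
Variables (beta beta1 beta2 mu mu_m : R).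
Hypotheses (beta01 : 0 <= beta < 1) (beta12 : beta1 + beta2 = beta).
Hypothesis beta12_0 : beta1 * beta2 = 0.
Hypothesis mu_muE : mu = mu_m / (1 - beta).
Variables (x w psi : int -> T -> 'cV[R]_M).
Hypothesis start : psi (-2) = w (-2).
Hypothesis lms : lms_recursion mu d u x.
Hypothesis mlms : momentum_lms_recursion mu_m beta1 beta2 d u w psi.

(** In the sequences below the index [k] stands for the time [k - 1], so that
    they start at the time [-1]. *)
Definition velocity (k : nat) (t : T) : 'cV[R]_M :=
  w (k%:Z - 1) t - w (k%:Z - 2) t.

(** The combination of position and velocity in which momentum disappears: its
    increments are gradient steps of size [mu_m / (1 - beta) = mu]. *)
Definition extrapolated (k : nat) (t : T) : 'cV[R]_M :=
  w (k%:Z - 1) t + (beta / (1 - beta)) *: velocity k t.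

Definition extrapolated_error (k : nat) (t : T) : 'cV[R]_M :=
  w_opt - extrapolated k t.

Definition extrapolated_gap (k : nat) (t : T) : 'cV[R]_M :=
  extrapolated k t - x (k%:Z - 1) t.

Definition lag_coef : R := beta / (1 - beta) - beta1.

Let ob0 : 1 - beta != 0. Proof. by case/andP: beta01 => _ b1; rewrite subr_eq0 gt_eqF. Qed.

Lemma momentum_psiE (k : nat) t :
  psi (k%:Z - 1) t = extrapolated k t - lag_coef *: velocity k t.
Proof.
rewrite (momentum_psi mlms)// /extrapolated /velocity /lag_coef.
by apply/matrixP => a b; rewrite !mxE; ring.
Qed.

Lemma innovationE (k : nat) t (y : 'cV[R]_M) :
  (d k t - dotv (u k t) y) *: u k t =
  R_u *m (w_opt - y) - fluctuation R_u u k (fun=> w_opt - y) t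
  + measurement_noise u v k t.
Proof.
rewrite fluctuationE linear_model// /measurement_noise subKr -scalerDl; congr (_ *: _).
by rewrite dotvDr dotvNr; ring.
Qed.

(** The two variants of momentum agree here: one of [beta1], [beta2] vanishes
    and the other equals [beta]. *)
Lemma velocity_step (k : nat) t :
  velocity k.+1 t = beta *: velocity k t
    + mu_m *: ((d k t - dotv (u k t) (psi (k%:Z - 1) t)) *: u k t).
Proof.
have e1 : k.+1%:Z - 1 = k by rewrite -addn1 PoszD addrK.
have e2 : k.+1%:Z - 2 = k%:Z - 1 by rewrite -addn1 PoszD; ring.
rewrite {1}/velocity e1 e2 (momentum_w mlms)//.
set q := mu_m *: _.
have pE := momentum_psi mlms t (leq0n k : 0 <= k%:Z).
rewrite {1}pE -/(velocity k t).
have [b20|b2n0] := eqVneq beta2 0.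
  have -> : beta1 = beta by rewrite -beta12 b20 addr0.
  rewrite b20; move: (velocity k t) (q) => m {}q.
  by apply/matrixP => a b; rewrite !mxE; ring.
have b10 : beta1 = 0.
  by move/eqP: beta12_0; rewrite mulf_eq0 (negbTE b2n0) orbF => /eqP.
have -> : beta2 = beta by rewrite -beta12 b10 add0r.
have pE2 : psi (k%:Z - 2) t = w (k%:Z - 2) t.
  case: k {pE q e1 e2} => [|k]; first by rewrite sub0r start.
  have -> : k.+1%:Z - 2 = k%:Z - 1 by rewrite -addn1 PoszD; ring.
  by rewrite (momentum_psi mlms)// b10 scale0r addr0.
rewrite pE pE2 b10 !scale0r !addr0.
rewrite /velocity; move: (q) => {}q.
by apply/matrixP => a b; rewrite !mxE; ring.
Qed.

Lemma extrapolated_step (k : nat) t :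
  extrapolated k.+1 t = extrapolated k t
    + mu *: ((d k t - dotv (u k t) (psi (k%:Z - 1) t)) *: u k t).
Proof.
have e1 : k.+1%:Z - 1 = k by rewrite -addn1 PoszD addrK.
have e2 : k.+1%:Z - 2 = k%:Z - 1 by rewrite -addn1 PoszD; ring.
have wE : w k t = w (k%:Z - 1) t + velocity k.+1 t.
  by rewrite /velocity e1 e2 addrC subrK.
rewrite /extrapolated e1 wE velocity_step.
set m := velocity k t; set q := _ *: u k t.
rewrite -!addrA; congr (_ + _).
apply/matrixP => a b; rewrite !mxE mu_muE; field; exact: ob0.
Qed.

Let lag k t := extrapolated_error k t + lag_coef *: velocity k t.

Let lagE k t : w_opt - psi (k%:Z - 1) t = lag k t.
Proof. by rewrite momentum_psiE /lag /extrapolated_error opprB addrA addrAC. Qed.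

Lemma velocity_stepE (k : nat) t :
  velocity k.+1 t = beta *: velocity k t + ((1 - beta) * mu) *:
    (R_u *m lag k t - fluctuation R_u u k (lag k) t + measurement_noise u v k t).
Proof.
rewrite velocity_step innovationE lagE mu_muE; congr (_ + _ *: _).
by rewrite mulrCA divff ?mulr1.
Qed.

Lemma extrapolated_error_stepE (k : nat) t :
  extrapolated_error k.+1 t = extrapolated_error k t - mu *: (R_u *m lag k t)
    + mu *: fluctuation R_u u k (lag k) t - mu *: measurement_noise u v k t.
Proof.
rewrite {1}/extrapolated_error extrapolated_step innovationE lagE.
rewrite -[fluctuation _ _ _ (fun=> _) t]/(fluctuation R_u u k (lag k) t).
move: (R_u *m _) (fluctuation _ _ _ _ _) (measurement_noise _ _ _ _) => Rp F n.
by rewrite /extrapolated_error; apply/matrixP => a b; rewrite !mxE; ring.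
Qed.

(** Both recursions see the same measurement noise, which cancels. *)
Lemma extrapolated_gap_stepE (k : nat) t :
  let p t := extrapolated_gap k t + (- lag_coef) *: velocity k t in
  extrapolated_gap k.+1 t = extrapolated_gap k t - mu *: (R_u *m p t)
    + mu *: fluctuation R_u u k p t.
Proof.
move=> p; have e1 : k.+1%:Z - 1 = k by rewrite -addn1 PoszD addrK.
rewrite {1}/extrapolated_gap e1 extrapolated_step lms// !innovationE.
have -> : R_u *m (w_opt - psi (k%:Z - 1) t) = R_u *m (w_opt - x (k%:Z - 1) t) - R_u *m p t.
  rewrite -mulmxBr; congr (_ *m _); rewrite /p momentum_psiE /extrapolated_gap.
  by apply/matrixP => a b; rewrite !mxE; ring.
have -> : fluctuation R_u u k (fun=> w_opt - psi (k%:Z - 1) t) t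
   = fluctuation R_u u k (fun=> w_opt - x (k%:Z - 1) t) t - fluctuation R_u u k p t.
  rewrite /fluctuation -mulmxBr; congr (_ *m _); rewrite /p momentum_psiE /extrapolated_gap.
  by apply/matrixP => a b; rewrite !mxE; ring.
rewrite /extrapolated_gap.
move: (fluctuation _ _ _ p t) (fluctuation _ _ _ _ t) => F Fx.
move: (R_u *m p t) (R_u *m (w_opt - _)) => Rp Rx.
by apply/matrixP => a b; rewrite !mxE; ring.
Qed.

Lemma iterate_gapE (n : nat) t :
  w n%:Z t - x n%:Z t =
  extrapolated_gap n.+1 t - (beta / (1 - beta)) *: velocity n.+1 t.
Proof.
have e1 : n.+1%:Z - 1 = n by rewrite -addn1 PoszD addrK.
rewrite /extrapolated_gap /extrapolated e1.
by apply/matrixP => a b; rewrite !mxE; ring.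
Qed.

Hypothesis d_meas : forall i, data_times i -> measurable_fun [set: T] (d i).
Hypothesis u_meas : forall i, data_times i -> random_vector (u i).
Hypotheses (mx_init : random_vector (x (-1))) (mw_init : random_vector (w (-2))).

Let random_vector_correction i y : data_times i -> random_vector y ->
  random_vector (fun t => (d i t - dotv (u i t) (y t)) *: u i t).
Proof.
move=> di my; apply: random_vectorZ; last exact: u_meas.
by apply: measurable_funB; [exact: d_meas|apply: measurable_dotv => //; exact: u_meas].
Qed.

Lemma iterates_random_vector (k : nat) :
  [/\ random_vector (x (k%:Z - 1)), random_vector (w (k%:Z - 1)),
      random_vector (w (k%:Z - 2)) & random_vector (psi (k%:Z - 2))].
Proof.
elim: k => [|k [mx mw mw2 mpsi2]].
  rewrite !sub0r start; split => //.
  rewrite (funext (momentum_start mlms)); apply: random_vectorD => //.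
  by apply: random_vectorZc; apply: random_vector_correction.
have e1 : k.+1%:Z - 1 = k by rewrite -addn1 PoszD addrK.
have e2 : k.+1%:Z - 2 = k%:Z - 1 by rewrite -addn1 PoszD; ring.
have dk : data_times k by exact: data_times_nat.
have mpsi : random_vector (psi (k%:Z - 1)).
  rewrite (funext (fun t => momentum_psi mlms t (leq0n k : 0 <= k%:Z))).
  apply: random_vectorD => //; apply: random_vectorZc; exact: random_vectorB.
rewrite e1 e2; split => //.
- rewrite (funext (fun t => lms t (leq0n k : 0 <= k%:Z))).
  apply: random_vectorD => //; apply: random_vectorZc.
  exact: random_vector_correction.
- rewrite (funext (fun t => momentum_w mlms t (leq0n k : 0 <= k%:Z))).
  apply: random_vectorD.
    apply: random_vectorD => //; apply: random_vectorZc.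
    exact: random_vector_correction.
  by apply: random_vectorZc; apply: random_vectorB.
Qed.

Lemma iterates_history_measurable (k : nat) :
  forall A, history x w psi (k%:Z - 1) A -> measurable A.
Proof.
apply: history_measurable => j /andP[j1 _].
- have -> : j = (absz (j + 1))%:Z - 1 by rewrite gez0_abs; lia.
  by case: (iterates_random_vector (absz (j + 1))).
- have -> : j = (absz (j + 2))%:Z - 2 by rewrite gez0_abs; lia.
  by case: (iterates_random_vector (absz (j + 2))).
Qed.

Lemma iterates_adapted (k : nat) :
  let G := history x w psi (k%:Z - 1) in
  [/\ adapted G (velocity k), adapted G (extrapolated_error k) &
      adapted G (extrapolated_gap k)].
Proof.
move=> G.
have ax : adapted G (x (k%:Z - 1)).
  by apply: adapted_of_events => A xA; left; exists (k%:Z - 1) => //=; lia.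
have aw : adapted G (w (k%:Z - 1)).
  by apply: adapted_of_events => A xA; right; exists (k%:Z - 1) => /=; [lia|left].
have aw2 : adapted G (w (k%:Z - 2)).
  by apply: adapted_of_events => A xA; right; exists (k%:Z - 2) => /=; [lia|left].
have am : adapted G (velocity k) by exact: random_vectorB.
have az : adapted G (extrapolated k).
  by apply: random_vectorD => //; exact: random_vectorZc.
split => //; apply: random_vectorB => //; exact: random_vector_cst.
Qed.

Variables (P : probability T R) (gamma sigma_s nu r : R).
Hypothesis v_meas : forall i, data_times i -> measurable_fun [set: T] (v i).
Hypothesis noise : forall i : int, 0 <= i ->
  noise_condition P R_u w_opt u v gamma sigma_s i (history x w psi (i - 1)).
Hypotheses (nu0 : 0 < nu) (mu0 : 0 < mu) (mu1 : mu <= 1) (munu : mu * nu <= 1).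
Hypothesis nuR : loewner_le nu%:M R_u.
Hypotheses (r0 : 0 <= r) (rR : forall b, sqnorm (R_u *m b) <= r * sqnorm b).
Hypothesis mur : mu * (2 * r + 2 * gamma ^+ 2) <= nu / 2.
Hypotheses (im0 : sq_integrable P (velocity 0))
  (iz0 : sq_integrable P (extrapolated_error 0))
  (ie0 : sq_integrable P (extrapolated_gap 0)).

(** Dominates every constant of the one-step bounds, so that one constant serves
    in the three recursions. *)
Definition coupling_rate : R :=
  2 * drift_rate gamma nu r lag_coef + (1 + 4 / nu)
  + (4 * r + 4 * gamma ^+ 2) * (1 + lag_coef ^+ 2) + 2.

Lemma coupling_rate_ge :
  [/\ 2 * drift_rate gamma nu r lag_coef <= coupling_rate,
      1 + 4 / nu <= coupling_rate,
      4 * r + 4 * gamma ^+ 2 <= coupling_rate,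
      (4 * r + 4 * gamma ^+ 2) * lag_coef ^+ 2 <= coupling_rate & 2 <= coupling_rate].
Proof.
have d0 := drift_rate_ge0 gamma nu0 r0 lag_coef.
have n0 : 0 <= 4 / nu by rewrite divr_ge0// ltW.
have g0 : 0 <= 4 * r + 4 * gamma ^+ 2.
  by apply: addr_ge0; apply: mulr_ge0 => //; exact: sqr_ge0.
have := nonneg_sum_bounds d0 n0 (mulr_ge0 g0 (sqr_ge0 lag_coef)) g0.
by rewrite /coupling_rate mulrDr mulr1.
Qed.

Lemma coupling_rate_gt0 : 0 < coupling_rate.
Proof. by have [_ _ _ _] := coupling_rate_ge; exact: lt_le_trans. Qed.

Lemma mean_sq_recursions (k : nat) :
  let Z k := mean_sq P (extrapolated_error k) in
  let Q k := mean_sq P (velocity k) in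
  let E k := mean_sq P (extrapolated_gap k) in
  [/\ sq_integrable P (velocity k), sq_integrable P (extrapolated_error k)
    & sq_integrable P (extrapolated_gap k)] /\
  [/\ Z k.+1 <= (1 - mu * nu) * Z k + coupling_rate * mu * Q k
                + coupling_rate * mu * sigma_s ^+ 2,
      Q k.+1 <= (beta + coupling_rate * mu ^+ 2) * Q k
                + coupling_rate * mu ^+ 2 * (Z k + sigma_s ^+ 2)
    & E k.+1 <= (1 - mu * nu) * E k + coupling_rate * mu * Q k].
Proof.
move=> Z Q E.
have drN : drift_rate gamma nu r (- lag_coef) = drift_rate gamma nu r lag_coef.
  by rewrite /drift_rate sqrrN.
have [hc1 hc2 hc3 hc4 hc5] := coupling_rate_ge.
have s0 : 0 <= sigma_s ^+ 2 by exact: sqr_ge0.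
have m20 : 0 <= mu ^+ 2 by exact: sqr_ge0.
have step j : sq_integrable P (velocity j) -> sq_integrable P (extrapolated_error j) ->
    sq_integrable P (extrapolated_gap j) ->
  [/\ sq_integrable P (velocity j.+1), sq_integrable P (extrapolated_error j.+1)
    & sq_integrable P (extrapolated_gap j.+1)] /\
  [/\ Z j.+1 <= (1 - mu * nu) * Z j + coupling_rate * mu * Q j
                + coupling_rate * mu * sigma_s ^+ 2,
      Q j.+1 <= (beta + coupling_rate * mu ^+ 2) * Q j
                + coupling_rate * mu ^+ 2 * (Z j + sigma_s ^+ 2)
    & E j.+1 <= (1 - mu * nu) * E j + coupling_rate * mu * Q j].
  move=> im iz ie.
  have [am az ae] := iterates_adapted j.
  have Gm := iterates_history_measurable (k := j).
  have dj := data_times_nat j.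
  have nj := noise (leq0n j : 0 <= j%:Z).
  have Z0 : 0 <= Z j by exact: mean_sq_ge0.
  have Q0 : 0 <= Q j by exact: mean_sq_ge0.
  have E0 : 0 <= E j by exact: mean_sq_ge0.
  have [iz' bz] := mean_sq_noisy_gradient_step Gm (u_meas dj) (v_meas dj) nj
    nu0 mu0 mu1 munu nuR r0 rR mur lag_coef az iz am im.
  have [im' bm] := mean_sq_momentum_step Gm (u_meas dj) (v_meas dj) nj
    mu r0 rR lag_coef beta01 az iz am im.
  have [ie' be] := mean_sq_gradient_step Gm (u_meas dj) (v_meas dj) nj
    nu0 mu0 mu1 munu nuR r0 rR mur (- lag_coef) ae ie am im.
  rewrite -(funext (extrapolated_error_stepE j)) in iz' bz.
  rewrite -(funext (velocity_stepE j)) in im' bm.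
  rewrite -(funext (extrapolated_gap_stepE j)) in ie' be.
  have mQ := mulr_ge0 (ltW mu0) Q0; have mS := mulr_ge0 (ltW mu0) s0.
  rewrite drN in be.
  split => //; split.
  - apply: le_trans bz _; rewrite -/(Z j) -/(Q j).
    rewrite -addrA -[leRHS]addrA lerD2l; apply: lerD.
      by rewrite -[leLHS]mulrA -[leRHS]mulrA ler_wpM2r.
    by rewrite -[leLHS]mulrA -[leRHS]mulrA ler_wpM2r.
  - apply: le_trans bm _; rewrite -/(Z j) -/(Q j).
    have -> : (beta + coupling_rate * mu ^+ 2) * Q j +
       coupling_rate * mu ^+ 2 * (Z j + sigma_s ^+ 2) =
      beta * Q j + mu ^+ 2 * (coupling_rate * (Z j + Q j + sigma_s ^+ 2)) by ring.
    rewrite lerD2l ler_wpM2l// !mulrDr [_ * (lag_coef ^+ 2 * _)]mulrA.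
    by apply: lerD; [apply: lerD|]; apply: ler_wpM2r.
  - apply: le_trans be _; rewrite -/(E j) -/(Q j).
    apply: lerD.
      apply: ler_wpM2r => //; rewrite lerD2l lerN2 ler_peMl//; last by rewrite ler_pdivlMr// mul1r ler_nat.
      exact: mulr_ge0 (ltW mu0) (ltW nu0).
    rewrite -[leLHS]mulrA -[leRHS]mulrA ler_wpM2r// (le_trans _ hc1)//.
    by rewrite ler_peMl// ?drift_rate_ge0// ler1n.
suff [im iz ie] : [/\ sq_integrable P (velocity k),
    sq_integrable P (extrapolated_error k) & sq_integrable P (extrapolated_gap k)].
  by split => //; case: (step k im iz ie).
by elim: k => [//|k [im iz ie]]; case: (step k im iz ie).
Qed.

End Trajectories.

(** * Comparison of the two recursions *)

Section Initialisation.
Context {disp : measure_display} {T : measurableType disp} {R : realType}.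
Context {M : nat}.
Variable P : probability T R.
Variables (d : int -> T -> R) (u : int -> T -> 'cV[R]_M).
Variables (w_opt : 'cV[R]_M) (beta : R) (w_init : T -> 'cV[R]_M).
Hypothesis beta01 : 0 <= beta < 1.

Let kap := 1 + beta / (1 - beta).

Let ob0 : 0 < 1 - beta. Proof. by case/andP: beta01 => _; rewrite subr_gt0. Qed.

Definition first_correction (t : T) : 'cV[R]_M :=
  (d (-1) t - dotv (u (-1) t) (w_init t)) *: u (-1) t.

Definition initial_level : R :=
  2 * mean_sq P (fun t => w_opt - w_init t)
  + 2 * (kap ^+ 2 * mean_sq P first_correction).

Lemma initial_level_ge0 : 0 <= initial_level.
Proof.
have h := mulr_ge0 (sqr_ge0 kap) (mean_sq_ge0 P first_correction).
by apply: addr_ge0; apply: mulr_ge0 => //; exact: mean_sq_ge0.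
Qed.

(** The first velocity is [mu (1 - beta)] times a random vector that does not
    depend on the step-size, so its mean square is of order [mu ^+ 2]. That
    random vector is square integrable because [w (-1)] is. *)
Lemma initial_mean_squares (mu : R) (x w : int -> T -> 'cV[R]_M) :
  0 < mu <= 1 -> w (-2) = w_init -> x (-1) = w_init ->
  (forall t, w (-1) t = w (-2) t + (mu * (1 - beta)) *: first_correction t) ->
  sq_integrable P w_init -> sq_integrable P (w (-1)) ->
  [/\ sq_integrable P (velocity w 0), sq_integrable P (extrapolated_error w_opt beta w 0)
    & sq_integrable P (extrapolated_gap beta x w 0)] /\
  [/\ mean_sq P (extrapolated_error w_opt beta w 0) <= initial_level,
      mean_sq P (velocity w 0) <= initial_level * mu ^+ 2
    & mean_sq P (extrapolated_gap beta x w 0) <= initial_level * mu ^+ 2].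
Proof.
move=> /andP[mu0 mu1] wN2 xN1 wN1 iw iw1.
have mb0 : mu * (1 - beta) != 0 by rewrite mulf_neq0 ?gt_eqF.
have v0E t : velocity w 0 t = w (-1) t - w_init t by rewrite /velocity !sub0r wN2.
have im : sq_integrable P (velocity w 0) by rewrite (funext v0E); exact: sq_integrableB.
have vE t : velocity w 0 t = (mu * (1 - beta)) *: first_correction t.
  by rewrite v0E wN1 wN2 addrAC subrr add0r.
have iq : sq_integrable P first_correction.
  have qE t : first_correction t = (mu * (1 - beta))^-1 *: velocity w 0 t.
    by rewrite vE [RHS]scalerA mulVf// scale1r.
  by rewrite (funext qE); exact: sq_integrableZ.
have gE t : extrapolated_gap beta x w 0 t = kap *: velocity w 0 t.
  rewrite /extrapolated_gap /extrapolated sub0r xN1 /kap.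
  by rewrite scalerDl scale1r {2}v0E addrAC.
have zE t : extrapolated_error w_opt beta w 0 t =
    (w_opt - w_init t) + (- kap) *: velocity w 0 t.
  rewrite /extrapolated_error /extrapolated sub0r v0E /kap.
  by apply/matrixP => a b; rewrite !mxE; ring.
have iW : sq_integrable P (fun t => w_opt - w_init t).
  by apply: sq_integrableB => //; exact: sq_integrable_cst.
have [iz bz] : sq_integrable P (extrapolated_error w_opt beta w 0) /\
    mean_sq P (extrapolated_error w_opt beta w 0) <=
    2 * mean_sq P (fun t => w_opt - w_init t) + (2 * kap ^+ 2) * mean_sq P (velocity w 0).
  rewrite (funext zE); apply: mean_sq_le => // [|t].
    by apply: random_vectorD; [exact: iW.1|exact: random_vectorZc im.1].
  apply: le_trans (sqnormD2 _ _) _.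
  by rewrite sqnormZ sqrrN mulrA.
have ig : sq_integrable P (extrapolated_gap beta x w 0).
  by rewrite (funext gE); exact: sq_integrableZ.
have gv : mean_sq P (extrapolated_gap beta x w 0) = kap ^+ 2 * mean_sq P (velocity w 0).
  by rewrite (funext gE) mean_sqZ.
split=> //; rewrite gv /initial_level.
have W0 := mean_sq_ge0 P (fun t => w_opt - w_init t).
set W := mean_sq P (fun t => w_opt - w_init t) in bz W0 *.
have K0 := mean_sq_ge0 P first_correction; set K := mean_sq P first_correction in K0 *.
have vK : mean_sq P (velocity w 0) <= K * mu ^+ 2.
  rewrite (funext vE) mean_sqZ// mulrC ler_wpM2l// exprMn ler_piMr ?sqr_ge0//.
  by case/andP: beta01 => b0 b1; rewrite expr_le1// ?(ltW ob0)// lerBlDr lerDl.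
have k1 : K <= kap ^+ 2 * K.
  rewrite ler_peMl// exprn_ege1// /kap lerDl divr_ge0// ?(ltW ob0)//.
  by case/andP: beta01.
have level : kap ^+ 2 * K <= 2 * W + 2 * (kap ^+ 2 * K).
  rewrite [2 * (_ * K)]mulr_natl mulr2n addrA lerDr.
  by apply: addr_ge0; [exact: mulr_ge0|exact: le_trans K0 k1].
have m20 : 0 <= mu ^+ 2 by exact: sqr_ge0.
split.
- apply: le_trans bz _; rewrite lerD2l -mulrA ler_pM2l// ler_wpM2l ?sqr_ge0//.
  by apply: le_trans vK _; rewrite ler_piMr// expr_le1// ltW.
- by apply: le_trans vK _; rewrite ler_wpM2r// (le_trans k1).
- apply: le_trans (ler_wpM2l (sqr_ge0 kap) vK) _.
  by rewrite [leLHS]mulrA ler_wpM2r.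
Qed.

End Initialisation.

Section Comparison.
Context {disp : measure_display} {T : measurableType disp} {R : realType}.
Context {M : nat}.
Variable P : probability T R.
Variables (d v : int -> T -> R) (u : int -> T -> 'cV[R]_M).
Variables (w_opt : 'cV[R]_M) (R_u : 'M[R]_M) (sigma_d sigma_v : R).
Variables (nu gamma sigma_s beta beta1 beta2 : R) (w_init : T -> 'cV[R]_M).
Hypothesis model : mse_data_model P d v u w_opt R_u sigma_d sigma_v.

Lemma data_model_hessian i a : data_times i ->
  hessian (mse_risk P (d i) (u i)) a = R_u.
Proof.
move=> di; apply: hessian_mse_risk.
- exact: mse_d_meas model _ di.
- exact: mse_u_meas model _ di.
- have [/(_ i (lshift M 0) di) + _ _] := mse_stationary model.
  rewrite (_ : (fun t => _) = (fun t => d i t ^+ 2)) //.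
  by apply/funext => t; rewrite col_mxEu mxE mulr1n.
- by move=> k l; exact: mse_u_cov model _ _ _ di.
Qed.

Hypotheses (nu0 : 0 < nu) (nuR : loewner_le nu%:M R_u).
Hypotheses (beta01 : 0 <= beta < 1) (beta12 : beta1 + beta2 = beta).
Hypothesis beta12_0 : beta1 * beta2 = 0.
Hypothesis mw_init : random_vector w_init.
Hypothesis w_init2 : ('E_P[fun t => sqnorm (w_init t)] < +oo)%E.

(** The comparison with all constants but [mu] and [n] collected in one; the
    extrapolated gap and the velocity are recombined into [w n - x n]. *)
Lemma momentum_lms_gap_bound : exists mu_bar C : R, [/\ 0 < mu_bar, 0 <= C &
  forall (mu mu_m : R) (x w psi : int -> T -> 'cV[R]_M),
    0 < mu < mu_bar -> mu = mu_m / (1 - beta) ->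
    psi (-2) = w_init -> w (-2) = w_init -> x (-1) = w_init ->
    lms_recursion mu d u x ->
    momentum_lms_recursion mu_m beta1 beta2 d u w psi ->
    ('E_P[fun t => sqnorm (w (-1)%R t)] < +oo)%E ->
    (forall i : int, 0 <= i ->
       noise_condition P R_u w_opt u v gamma sigma_s i
         (history x w psi (i - 1))) ->
    let rho := 1 - mu * nu / 2 in
    0 < rho < 1 /\
    forall n : nat, exists2 e : R,
      'E_P[fun t => sqnorm (w n%:Z t - x n%:Z t)%R]%E = e%:E &
      e <= C * (rho ^+ n.+1 * mu ^+ 2 + sigma_s ^+ 2 * mu ^+ 2
                + n.+1%:R * rho ^+ n.+1 * mu ^+ 3)].
Proof.
have [r r0 rR] := sqnorm_mulmx_bounded R_u.
have ob0 : 0 < 1 - beta by case/andP: beta01 => _; rewrite subr_gt0.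
have c0 := coupling_rate_gt0 beta beta1 gamma nu0 r0.
have init0 := initial_level_ge0 P d u w_opt beta w_init.
have [mu_bar [C [mu_bar0 mu_bar1 C0 bound]]] :=
  coupled_recursion_bound nu0 beta01 c0 init0.
pose q := 4 * (r + gamma ^+ 2) + 1.
have q0 : 0 < q by rewrite ltr_wpDl// mulr_ge0// addr_ge0// sqr_ge0.
have kap0 : 0 <= (beta / (1 - beta)) ^+ 2 by exact: sqr_ge0.
exists (Num.min mu_bar (Num.min nu^-1 (nu / q))).
exists ((2 + 2 * (beta / (1 - beta)) ^+ 2) * C); split.
- by rewrite !lt_min mu_bar0 invr_gt0 nu0 divr_gt0.
- by rewrite mulr_ge0// addr_ge0// mulr_ge0.
move=> mu mu_m x w psi /andP[mu0]; rewrite !lt_min => /and3P[mub munu muq].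
have mur : mu * (2 * r + 2 * gamma ^+ 2) <= nu / 2.
  by move: muq; rewrite ltr_pdivlMr// /q; lra.
move=> muE psi2 wN2 xN1 lms mlms wN1 noise rho.
have mu_in : 0 < mu < mu_bar by rewrite mu0.
have mu1 : mu <= 1 by apply: ltW; exact: lt_le_trans mub mu_bar1.
have mn1 : mu * nu <= 1 by rewrite -ler_pdivlMr// mul1r ltW.
have [rho01 recur] := bound mu (sigma_s ^+ 2) mu_in (sqr_ge0 _).
split => // n.
have dm i (di : data_times i) : measurable_fun [set: T] (d i) := mse_d_meas model di.
have um i (di : data_times i) : random_vector (u i) := mse_u_meas model di.
have [vm _ _] := mse_v_white model.
have start : psi (-2) = w (-2) by rewrite psi2 wN2.
have iw : sq_integrable P w_init by exact: sq_integrableP.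
have mx1 : random_vector (x (-1)) by rewrite xN1.
have mw2 : random_vector (w (-2)) by rewrite wN2.
have iw1 : sq_integrable P (w (-1)).
  apply: sq_integrableP => //.
  by have [] := iterates_random_vector start lms mlms dm um mx1 mw2 0; rewrite sub0r.
have w1E t : w (-1) t = w (-2) t + (mu * (1 - beta)) *: first_correction d u w_init t.
  by rewrite (momentum_start mlms) /first_correction wN2 muE divfK// gt_eqF.
have mu01 : 0 < mu <= 1 by rewrite mu0.
have [[im0 iz0 ie0] [bz0 bm0 be0]] :=
  initial_mean_squares w_opt beta01 mu01 wN2 xN1 w1E iw iw1.
have rec k := mean_sq_recursions (mse_linear model) beta01 beta12 beta12_0 muE
  start lms mlms dm um mx1 mw2 vm noise nu0 mu0 mu1 mn1 nuR r0 rR mur im0 iz0 ie0 k.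
have EQ := recur (fun k => mean_sq P (extrapolated_error w_opt beta w k))
  (fun k => mean_sq P (velocity w k))
  (fun k => mean_sq P (extrapolated_gap beta x w k))
  (fun k => mean_sq_ge0 _ _) (fun k => mean_sq_ge0 _ _) (fun k => mean_sq_ge0 _ _)
  bz0 bm0 be0 (fun k => let: conj _ (And3 h _ _) := rec k in h)
  (fun k => let: conj _ (And3 _ h _) := rec k in h)
  (fun k => let: conj _ (And3 _ _ h) := rec k in h) n.+1.
have [[im iz ie] _] := rec n.+1.
have [ig bg] : sq_integrable P (fun t => w n%:Z t - x n%:Z t) /\
    mean_sq P (fun t => w n%:Z t - x n%:Z t) <=
    2 * mean_sq P (extrapolated_gap beta x w n.+1)
    + (2 * (beta / (1 - beta)) ^+ 2) * mean_sq P (velocity w n.+1).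
  rewrite (funext (iterate_gapE beta x w n)); apply: mean_sq_le => // [|t].
    by apply: random_vectorB; [exact: ie.1|exact: random_vectorZc im.1].
  apply: le_trans (sqnormD2 _ _) _.
  by rewrite sqnormN sqnormZ mulrA.
exists (mean_sq P (fun t => w n%:Z t - x n%:Z t)); first exact: expectation_sqnormE.
apply: le_trans bg _; rewrite -[leRHS]mulrA.
have Ek := mean_sq_ge0 P (extrapolated_gap beta x w n.+1).
have Qk := mean_sq_ge0 P (velocity w n.+1).
apply: (@le_trans _ _ ((2 + 2 * (beta / (1 - beta)) ^+ 2) *
    (mean_sq P (extrapolated_gap beta x w n.+1) + mean_sq P (velocity w n.+1)))).
  by rewrite [leRHS]mulrDr; apply: lerD; apply: ler_wpM2r => //;
    rewrite ?lerDl ?lerDr// mulr_ge0.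
by rewrite (mulrDl _ _ (mu ^+ 2)) in EQ; rewrite ler_wpM2l// addr_ge0// mulr_ge0.
Qed.

End Comparison.

(** Distributes a single hidden constant over terms that carry prescribed
    weights. *)
Lemma le_reweighted_sum (R : realFieldType) (a b c x y z : R) :
  0 < a -> 0 < b -> 0 < c -> 0 <= x -> 0 <= y -> 0 <= z ->
  x + y + z <= (a^-1 + b^-1 + c^-1) * (a * x + b * y + c * z).
Proof.
move=> a0 b0 c0 x0 y0 z0.
have weight (w p q s : R) : 0 < w -> 0 < p -> 0 < q -> 0 <= s ->
    s <= (w^-1 + p^-1 + q^-1) * (w * s).
  move=> w0 p0 q0 s0; rewrite mulrA ler_peMl// mulrDl mulrDl mulVf ?gt_eqF//.
  by rewrite -addrA lerDl addr_ge0// mulr_ge0 ?invr_ge0 ?ltW.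
have hx := weight a b c x a0 b0 c0 x0.
have hy := weight b a c y b0 a0 c0 y0.
have hz := weight c a b z c0 a0 b0 z0.
lra.
Qed.

Theorem theorem8 (disp : measure_display) (T : measurableType disp)
    (R : realType) (P : probability T R) (M : nat)
    (d v : int -> T -> R) (u : int -> T -> 'cV[R]_M)
    (w_opt : 'cV[R]_M) (R_u : 'M[R]_M) (sigma_d sigma_v : R)
    (nu delta gamma sigma_s beta beta1 beta2 epsilon : R)
    (w_init : T -> 'cV[R]_M) :
  mse_data_model P d v u w_opt R_u sigma_d sigma_v ->
  (* (i) *)
  0 < nu ->
  (forall i w, data_times i ->
     loewner_le nu%:M (hessian (mse_risk P (d i) (u i)) w) /\
     loewner_le (hessian (mse_risk P (d i) (u i)) w) delta%:M) ->
  (* (iii) *)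
  0 <= beta < 1 -> 0 < epsilon -> beta <= 1 - epsilon ->
  0 <= beta1 < 1 -> 0 <= beta2 < 1 ->
  beta1 + beta2 = beta -> beta1 * beta2 = 0 ->
  (* initial state with finite second moment *)
  random_vector w_init ->
  ('E_P[fun t => sqnorm (w_init t)] < +oo)%E ->
  exists mu_bar C : R, 0 < mu_bar /\
    forall (mu mu_m : R) (x w psi : int -> T -> 'cV[R]_M),
      0 < mu < mu_bar ->
      (* (v) *)
      mu = mu_m / (1 - beta) ->
      (* (iv) *)
      psi (-2) = w_init -> w (-2) = w_init -> x (-1) = w_init ->
      lms_recursion mu d u x ->
      momentum_lms_recursion mu_m beta1 beta2 d u w psi ->
      ('E_P[fun t => sqnorm (w (-1)%R t)] < +oo)%E ->
      (* (ii) *)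
      (forall i : int, 0 <= i ->
         noise_condition P R_u w_opt u v gamma sigma_s i
           (history x w psi (i - 1))) ->
      let rho1 := 1 - mu * nu / 2 in
      0 < rho1 < 1 /\
      forall n : nat,
        ('E_P[fun t => sqnorm (w n%:Z t - x n%:Z t)%R] <=
          (C * (((delta ^+ 2 + gamma ^+ 2) / (1 - beta) ^+ 2 * rho1 ^+ n.+1
                 + delta ^+ 2 * sigma_s ^+ 2 / (nu ^+ 2 * (1 - beta))) * mu ^+ 2
                + delta ^+ 2 * (delta ^+ 2 + gamma ^+ 2) * n.+1%:R
                  * rho1 ^+ n.+1 / (nu * (1 - beta) ^+ 2) * mu ^+ 3))%:E)%E.
Proof.
move=> model nu0 hess beta01 _ _ _ _ beta12 beta12_0 mw w2.
have [M0|M_gt0] := posnP M.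
  (* In dimension zero nothing forces [delta] to be nonzero, but both iterates
     coincide. *)
  exists nu^-1, 0; split; first by rewrite invr_gt0.
  move=> mu mu_m x w psi /andP[mu0 munu] _ _ _ _ _ _ _ _ rho1.
  have h1 : mu * nu < 1 by rewrite -ltr_pdivlMr// mul1r.
  have h0 : 0 < mu * nu by rewrite mulr_gt0.
  split; first by rewrite /rho1; lra.
  move=> n; rewrite mul0r (_ : (fun t => _) = cst 0) ?expectation_cst//.
  apply/funext => t /=; rewrite /sqnorm dotvE big1// => j _.
  by have := ltn_ord j; rewrite [X in (_ < X)%N]M0.
have d0 : data_times 0 by exact: data_times_nat 0.
have [nuR Rdelta] : loewner_le nu%:M R_u /\ loewner_le R_u delta%:M.
  by have := hess 0 0 d0; rewrite (data_model_hessian model _ d0).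
have delta0 : 0 < delta.
  pose j := Ordinal M_gt0.
  have := le_trans (nuR (delta_mx j 0)) (Rdelta (delta_mx j 0)).
  rewrite !mul_scalar_mx !dotvZr !dotv_delta_l mxE !eqxx !mulr1.
  exact: lt_le_trans.
have ob0 : 0 < 1 - beta by case/andP: beta01 => _; rewrite subr_gt0.
have [mu_bar [C [mu_bar0 C0 bound]]] := momentum_lms_gap_bound gamma sigma_s
  model nu0 nuR beta01 beta12 beta12_0 mw w2.
pose a1 := (delta ^+ 2 + gamma ^+ 2) / (1 - beta) ^+ 2.
pose a2 := delta ^+ 2 / (nu ^+ 2 * (1 - beta)).
pose a3 := delta ^+ 2 * (delta ^+ 2 + gamma ^+ 2) / (nu * (1 - beta) ^+ 2).
have dg0 : 0 < delta ^+ 2 + gamma ^+ 2 by rewrite ltr_wpDr ?sqr_ge0// exprn_gt0.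
have a10 : 0 < a1 by rewrite divr_gt0// exprn_gt0.
have a20 : 0 < a2 by rewrite divr_gt0 ?mulr_gt0 ?exprn_gt0.
have a30 : 0 < a3 by rewrite divr_gt0 ?mulr_gt0 ?exprn_gt0.
exists mu_bar, (C * (a1^-1 + a2^-1 + a3^-1)); split => //.
move=> mu mu_m x w psi mu_in muE psi2 wN2 xN1 lms mlms wN1 noise rho1.
have [rho01 gap] := bound mu mu_m x w psi mu_in muE psi2 wN2 xN1 lms mlms wN1 noise.
split => // n; have [e -> gap_n] := gap n.
rewrite -/rho1 in rho01 gap_n; have [rho0 _] := andP rho01.
have [mu0 _] := andP mu_in.
rewrite lee_fin; apply: le_trans gap_n _.
rewrite -[leRHS]mulrA; apply: ler_wpM2l => //.
have -> : delta ^+ 2 * sigma_s ^+ 2 / (nu ^+ 2 * (1 - beta)) = a2 * sigma_s ^+ 2.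
  by rewrite /a2 mulrAC.
have -> : delta ^+ 2 * (delta ^+ 2 + gamma ^+ 2) * n.+1%:R * rho1 ^+ n.+1
    / (nu * (1 - beta) ^+ 2) = a3 * (n.+1%:R * rho1 ^+ n.+1).
  by rewrite /a3 [RHS]mulrAC; congr (_ * _); exact/esym/mulrA.
rewrite -/a1 (mulrDl (a1 * _)) -(mulrA a1) -(mulrA a2) -(mulrA a3).
have rk0 : 0 <= rho1 ^+ n.+1 by rewrite exprn_ge0// ltW.
have m0 k : 0 <= mu ^+ k by rewrite exprn_ge0// ltW.
apply: le_reweighted_sum => //.
- exact: mulr_ge0.
- by apply: mulr_ge0 => //; exact: sqr_ge0.
- by apply: mulr_ge0 => //; exact: mulr_ge0.
Qed.
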